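(* Let $\mathcal N=(\hat{\mathcal K},\hat{\mathcal B})$ be a model of $T^R$, $A\subseteq\hat{\mathcal K}$ and $\mathbf b\in\hat{\mathcal K}$. Then $\mathbf b$ is definable over $A$ in $\mathcal N$ if and only if $\mathbf b=\lim_{m\to\infty}\mathbf b_m$ (in the metric $d_{\mathbb K}$) for some sequence of elements $\mathbf b_m\in\hat{\mathcal K}$, each of which is first-order definable over $A$. Thus $\mathrm{dcl}(A)=\mathrm{cl}(\mathrm{fdcl}(A))$.
   Context: $L$ is a finite or countable first-order signature and $T$ is a complete first-order $L$-theory all of whose models have at least two elements. The randomization signature $L^R$ is the two-sorted continuous-logic signature with a sort $\mathbb K$ (random elements) and a sort $\mathbb B$ (events). It has: for each first-order $L$-formula $\varphi$ with $n$ free variables, a function symbol $[\![\varphi(\cdot)]\!]$ of sort $\mathbb K^n\to\mathbb B$; a $[0,1]$-valued predicate $\mu$ on $\mathbb B$; the Boolean operations $\top,\bot,\sqcap,\sqcup,\neg$ on $\mathbb B$; and distance predicates $d_{\mathbb B}$ and $d_{\mathbb K}$. Given $\mathcal M\models T$, a nice randomization of $\mathcal M$ is a pre-structure $(\mathcal K,\mathcal B)$ for $L^R$ with an atomless probability space $(\Omega,\mathcal B,\mu)$ satisfying the following. (i) $\mathcal B$ is a $\sigma$-algebra on $\Omega$, with the Boolean operations interpreted set-theoretically. (ii) $\mathcal K$ is a set of functions $\Omega\to M$. (iii) For each formula $\psi$ and tuple $\vec a$ from $\mathcal K$, $[\![\psi(\vec a)]\!]=\{\omega:\mathcal M\models\psi(\vec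 a(\omega))\}\in\mathcal B$. (iv) $\mathcal B$ consists exactly of such events. (v) For each $\theta(u,\vec v)$ and $\vec b$ from $\mathcal K$, there is $a\in\mathcal K$ with $[\![\theta(a,\vec b)]\!]=[\![(\exists u\,\theta)(\vec b)]\!]$. (vi) $d_{\mathbb K}(a,b)=\mu[\![a\ne b]\!]$. (vii) $d_{\mathbb B}(\mathsf B,\mathsf C)=\mu(\mathsf B\triangle\mathsf C)$. In addition, the reduction of the pre-structure (identifying elements at distance $0$) is already complete. $T^R$ is the set of continuous $L^R$-sentences true in all nice randomizations of models of $T$. A model of $T^R$ is written $\mathcal N=(\hat{\mathcal K},\hat{\mathcal B})$, with sort-$\mathbb K$ part $\hat{\mathcal K}$ and sort-$\mathbb B$ part $\hat{\mathcal B}$. In a continuous structure, an element $b$ is definable over $A$ if there are continuous formulas $\Phi_k(x,\vec a_k)$, with $\vec a_k$ tuples from $A$, whose values converge uniformly in $x$ to $d(x,b)$. $\mathrm{dcl}(A)$ is the set of elements of $\hat{\mathcal K}$ definable over $A$ in $\mathcal N$. A first-order formula $\varphi(u,\vec v)$ is functional if $T\models(\forall\vec v)(\exists^{\le1}u)\varphi(u,\vec v)$. An element $\mathbf b\in\hat{\mathcal K}$ is first-order definable over $A\subseteq\hat{\mathcal K}$ (written $\mathbf b\in\mathrm{fdcl}(A)$) if there are a functional formula $\varphi(u,\vec v)$ and a tuple $\vec{\mathbf a}$ from $A$ with $[\![\varphi(\mathbf b,\vec{\mathbf a})]\!]=\top$. $\mathrm{cl}$ denotes closure in the metric $d_{\mathbb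 K}$. *)

(* Defs.v *)
From HB Require Import structures.
From mathcomp Require Import all_boot all_order all_algebra.
From mathcomp Require Import all_classical all_reals all_analysis.

Set Implicit Arguments.
Unset Strict Implicit.
Unset Printing Implicit Defensive.

Import Order.TTheory GRing.Theory Num.Theory.
Import numFieldNormedType.Exports.

Local Open Scope classical_set_scope.
Local Open Scope ring_scope.

(* An n-tuple from X is a function 'I_n -> X; [scons x v] is the (n+1)-tuple
   (x, v_0, ..., v_(n-1)). *)
Definition scons (X : Type) (n : nat) (x : X) (v : 'I_n -> X) : 'I_n.+1 -> X :=
  fun i => if unlift ord0 i is Some j then v j else x.

Definition snil (X : Type) : 'I_0 -> X :=
  fun i => False_rect X (notF (ltn_ord i)).

Record signature := Signature {
  fsym : countType;
  farity : fsym -> nat;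
  rsym : countType;
  rarity : rsym -> nat
}.

(* Terms and formulas are well scoped: the free variables of [phi : formula L n]
   are among the n variables indexed by 'I_n.  In [FEx phi] the quantified
   variable is index 0 of [phi] and the other variables are shifted by one. *)
Inductive term (L : signature) (n : nat) : Type :=
| TVar (i : 'I_n)
| TFun (f : fsym L) (ts : 'I_(farity f) -> term L n).

Inductive formula (L : signature) : nat -> Type :=
| FEq n (t s : term L n) : formula L n
| FRel n (r : rsym L) (ts : 'I_(rarity r) -> term L n) : formula L n
| FNot n (phi : formula L n) : formula L n
| FAnd n (phi psi : formula L n) : formula L n
| FEx n (phi : formula L n.+1) : formula L n.

Record structure (L : signature) := Structure {
  dom :> Type;
  dom_inhabited : inhabited dom;
  finterp : forall f : fsym L, ('I_(farity f) -> dom) -> dom;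
  rinterp : forall r : rsym L, ('I_(rarity r) -> dom) -> Prop
}.

Fixpoint teval (L : signature) (M : structure L) (n : nat) (t : term L n)
    (v : 'I_n -> M) : M :=
  match t with
  | TVar i => v i
  | TFun f ts => finterp (fun j => teval (ts j) v)
  end.

Fixpoint satisfies (L : signature) (M : structure L) (n : nat)
    (phi : formula L n) : ('I_n -> M) -> Prop :=
  match phi in formula _ n return ('I_n -> M) -> Prop with
  | FEq _ t s => fun v => teval t v = teval s v
  | FRel _ r ts => fun v => rinterp (fun j => teval (ts j) v)
  | FNot _ psi => fun v => ~ satisfies psi v
  | FAnd _ psi chi => fun v => satisfies psi v /\ satisfies chi v
  | FEx _ psi => fun v => exists x : M, satisfies psi (scons x v)
  end.

Definition theory (L : signature) := set (formula L 0).

Definition fomodel (L : signature) (T : theory L) (M : structure L) : Prop :=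
  forall phi, T phi -> satisfies phi (@snil M).

Definition entails (L : signature) (T : theory L) (phi : formula L 0) : Prop :=
  forall M : structure L, fomodel T M -> satisfies phi (@snil M).

Definition complete_theory (L : signature) (T : theory L) : Prop :=
  (exists M : structure L, fomodel T M) /\
  (forall phi : formula L 0, entails T phi \/ entails T (FNot phi)).

Definition functional (L : signature) (T : theory L) (n : nat)
    (phi : formula L n.+1) : Prop :=
  forall M : structure L, fomodel T M -> forall (v : 'I_n -> M) (u u' : M),
    satisfies phi (scons u v) -> satisfies phi (scons u' v) -> u = u'.

Record pseudometric01 (R : realType) (X : Type) (d : X -> X -> R) : Prop :=
  Pseudometric01 {
  pm_ge0 : forall x y, 0 <= d x y;
  pm_le1 : forall x y, d x y <= 1;
  pm_refl : forall x, d x x = 0;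
  pm_sym : forall x y, d x y = d y x;
  pm_triangle : forall x y z, d x z <= d x y + d y z
}.

(* A pseudometric space is complete in this sense iff its reduction, the
   quotient by [d x y = 0] with the induced metric, is a complete metric
   space. *)
Definition cauchy_complete (R : realType) (X : Type) (d : X -> X -> R) : Prop :=
  forall s : nat -> X,
    (forall e : R, 0 < e -> exists N : nat, forall i j : nat,
       (N <= i)%N -> (N <= j)%N -> d (s i) (s j) < e) ->
    exists x : X, (fun i => d (s i) x) @ \oo --> (0 : R).

(* The signature prescribes moduli of uniform continuity; here every symbol is
   1-Lipschitz in each argument. *)
Record prestructure (R : realType) (L : signature) := Prestructure {
  sortK : Type;
  sortB : Type;
  evt : forall n, formula L n -> ('I_n -> sortK) -> sortB;
  mu : sortB -> R;
  btop : sortB;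
  bbot : sortB;
  bcap : sortB -> sortB -> sortB;
  bcup : sortB -> sortB -> sortB;
  bneg : sortB -> sortB;
  dB : sortB -> sortB -> R;
  dK : sortK -> sortK -> R;
  sortK_inhabited : inhabited sortK;
  dB_pseudometric : pseudometric01 dB;
  dK_pseudometric : pseudometric01 dK;
  mu_ge0 : forall E, 0 <= mu E;
  mu_le1 : forall E, mu E <= 1;
  mu_lipschitz : forall E F, `|mu E - mu F| <= dB E F;
  evt_lipschitz : forall n (phi : formula L n) (a b : 'I_n -> sortK),
    dB (evt phi a) (evt phi b) <= \sum_(i < n) dK (a i) (b i);
  bcap_lipschitz : forall E E' F F',
    dB (bcap E F) (bcap E' F') <= dB E E' + dB F F';
  bcup_lipschitz : forall E E' F F',
    dB (bcup E F) (bcup E' F') <= dB E E' + dB F F';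
  bneg_lipschitz : forall E E', dB (bneg E) (bneg E') <= dB E E'
}.

Arguments evt {R L} p {n} phi a.
Arguments btop {R L} p.
Arguments bbot {R L} p.

Record is_structure (R : realType) (L : signature) (N : prestructure R L) :
    Prop := IsStructure {
  dK_separated : forall a b : sortK N, dK a b = 0 -> a = b;
  dB_separated : forall E F : sortB N, dB E F = 0 -> E = F;
  dK_complete : cauchy_complete (@dK R L N);
  dB_complete : cauchy_complete (@dB R L N)
}.

(* Only the restriction of [cfun] to the cube [0,1]^k is the connective; the
   values outside it never matter. *)
Definition cube (R : realType) (k : nat) : set 'rV[R]_k :=
  [set v | forall i, 0 <= v ord0 i <= 1].

Record connective (R : realType) (k : nat) := Connective {
  cfun : 'rV[R]_k -> R;
  cfun_continuous : {within @cube R k, continuous cfun};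
  cfun_range : forall v, cube v -> 0 <= cfun v <= 1
}.

(* [m] free variables of sort K (which are the only terms of sort K) and [n] of
   sort B.  The quantifiers bind the variable of index 0 of their sort. *)
Inductive bterm (L : signature) (m n : nat) : Type :=
| BVar (i : 'I_n)
| BEvt k (phi : formula L k) (x : 'I_k -> 'I_m)
| BTop
| BBot
| BCap (s t : bterm L m n)
| BCup (s t : bterm L m n)
| BNeg (s : bterm L m n).

Inductive cformula (R : realType) (L : signature) : nat -> nat -> Type :=
| CMu m n (t : bterm L m n) : cformula R L m n
| CDistB m n (s t : bterm L m n) : cformula R L m n
| CDistK m n (i j : 'I_m) : cformula R L m n
| CConn m n k (u : connective R k) (Phi : 'I_k -> cformula R L m n) :
    cformula R L m n
| CSupK m n (Phi : cformula R L m.+1 n) : cformula R L m n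
| CInfK m n (Phi : cformula R L m.+1 n) : cformula R L m n
| CSupB m n (Phi : cformula R L m n.+1) : cformula R L m n
| CInfB m n (Phi : cformula R L m n.+1) : cformula R L m n.

Fixpoint beval (R : realType) (L : signature) (N : prestructure R L)
    (m n : nat) (t : bterm L m n) (a : 'I_m -> sortK N) (e : 'I_n -> sortB N) :
    sortB N :=
  match t with
  | BVar i => e i
  | BEvt k phi x => evt N phi (fun j => a (x j))
  | BTop => btop N
  | BBot => bbot N
  | BCap s t => bcap (beval s a e) (beval t a e)
  | BCup s t => bcup (beval s a e) (beval t a e)
  | BNeg s => bneg (beval s a e)
  end.

Fixpoint cvalue (R : realType) (L : signature) (N : prestructure R L)
    (m n : nat) (Phi : cformula R L m n) :
    ('I_m -> sortK N) -> ('I_n -> sortB N) -> R :=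
  match Phi in cformula _ _ m n
    return ('I_m -> sortK N) -> ('I_n -> sortB N) -> R with
  | CMu _ _ t => fun a e => mu (beval t a e)
  | CDistB _ _ s t => fun a e => dB (beval s a e) (beval t a e)
  | CDistK _ _ i j => fun a _ => dK (a i) (a j)
  | CConn _ _ k u Psi => fun a e => cfun u (\row_j cvalue (Psi j) a e)
  | CSupK _ _ Psi => fun a e => sup (range (fun x => cvalue Psi (scons x a) e))
  | CInfK _ _ Psi => fun a e => inf (range (fun x => cvalue Psi (scons x a) e))
  | CSupB _ _ Psi => fun a e => sup (range (fun E => cvalue Psi a (scons E e)))
  | CInfB _ _ Psi => fun a e => inf (range (fun E => cvalue Psi a (scons E e)))
  end.

(* In continuous logic a sentence is true when its value is 0. *)
Definition ctrue (R : realType) (L : signature) (N : prestructure R L)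
    (Phi : cformula R L 0 0) : Prop :=
  cvalue Phi (@snil (sortK N)) (@snil (sortB N)) = 0.

Definition atomless (d : measure_display) (Omega : measurableType d)
    (R : realType) (P : probability Omega R) : Prop :=
  forall E : set Omega, measurable E -> (0 < P E)%E ->
    exists F : set Omega,
      [/\ measurable F, F `<=` E, (0 < P F)%E & (P F < P E)%E].

Definition event (L : signature) (M : structure L) (Omega : Type) (n : nat)
    (psi : formula L n) (a : 'I_n -> (Omega -> M)) : set Omega :=
  [set w | satisfies psi (fun i => a i w)].

Record nice_randomization (R : realType) (L : signature) (M : structure L) :=
  NiceRandomization {
  nr_display : measure_display;
  nr_space : measurableType nr_display;
  nr_prob : probability nr_space R;
  nr_atomless : atomless nr_prob;
  nr_K : set (nr_space -> M);
  nr_event_measurable : forall n (psi : formula L n) (a : 'I_n -> nr_space -> M),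
    (forall i, nr_K (a i)) -> measurable (event psi a);
  nr_measurable_event : forall E : set nr_space, measurable E ->
    exists n (psi : formula L n) (a : 'I_n -> nr_space -> M),
      (forall i, nr_K (a i)) /\ E = event psi a;
  nr_witness : forall n (theta : formula L n.+1) (b : 'I_n -> nr_space -> M),
    (forall i, nr_K (b i)) ->
    exists2 a, nr_K a & event theta (scons a b) = event (FEx theta) b;
  nr_complete_K : cauchy_complete (fun a b : {a | nr_K a} =>
    fine (nr_prob [set w | sval a w <> sval b w]));
  nr_complete_B : cauchy_complete (fun E F : {E : set nr_space | measurable E} =>
    fine (nr_prob (sval E `+` sval F)))
}.

Arguments nr_K {R L M} _ _.

Section NicePrestructure.
Variables (R : realType) (L : signature) (M : structure L).
Variable N : nice_randomization R M.

Let Omega := nr_space N.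
Let P : probability Omega R := nr_prob N.
Let K := {a : Omega -> M | nr_K N a}.
Let B := {E : set Omega | measurable E}.
Let pr (E : set Omega) : R := fine (P E).

Let measurableY (E F : set Omega) :
  measurable E -> measurable F -> measurable (E `+` F).
Proof. by move=> mE mF; apply: measurableU; apply: measurableD. Qed.

Let pr_ge0 E : 0 <= pr E.
Proof. by rewrite fine_ge0. Qed.

Let prE E : measurable E -> (pr E)%:E = P E.
Proof. by move=> mE; rewrite fineK// fin_num_measure. Qed.

Let pr_le1 E : measurable E -> pr E <= 1.
Proof. by move=> mE; rewrite -lee_fin prE// probability_le1. Qed.

Let pr0 : pr set0 = 0.
Proof. by rewrite /pr measure0. Qed.

Let le_pr E F : measurable E -> measurable F -> E `<=` F -> pr E <= pr F.
Proof. by move=> mE mF EF; rewrite -lee_fin !prE// le_measure// inE. Qed.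

Let pr_subU E F G : measurable E -> measurable F -> measurable G ->
  E `<=` F `|` G -> pr E <= pr F + pr G.
Proof.
move=> mE mF mG EFG; apply: (@le_trans _ _ (pr (F `|` G))).
  by apply: le_pr => //; exact: measurableU.
rewrite -lee_fin EFinD !prE//; last exact: measurableU.
exact: measureU2.
Qed.

Let pr_sub_sum n (E : set Omega) (F : 'I_n -> set Omega) : measurable E ->
  (forall i, measurable (F i)) -> (forall w, E w -> exists i, F i w) ->
  pr E <= \sum_(i < n) pr (F i).
Proof.
elim: n E F => [|n IH] E F mE mF EF.
  rewrite big_ord0; suff -> : E = set0 by rewrite pr0.
  by apply/seteqP; split => // w /EF[[]].
rewrite big_ord_recl.
apply: (@le_trans _ _ (pr (F ord0) + pr (E `\` F ord0))).
  apply: pr_subU => //; first exact: measurableD.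
  by move=> w Ew; have [?|?] := pselect (F ord0 w); [left|right].
rewrite lerD2l; apply: IH => //; first exact: measurableD.
move=> w [/EF[i Fi] nF0]; case: (unliftP ord0 i) Fi => [j ->|->] //.
by exists j.
Qed.

Definition nr_dK (a b : K) : R := pr [set w | sval a w <> sval b w].
Definition nr_dB (E F : B) : R := pr (sval E `+` sval F).

Definition nr_evt n (psi : formula L n) (a : 'I_n -> K) : B :=
  exist _ (event psi (fun i => sval (a i)))
    (nr_event_measurable psi (fun i => svalP (a i))).
Definition nr_top : B := exist _ setT measurableT.
Definition nr_bot : B := exist _ set0 measurable0.
Definition nr_cap (E F : B) : B :=
  exist _ (sval E `&` sval F) (measurableI _ _ (svalP E) (svalP F)).
Definition nr_cup (E F : B) : B :=
  exist _ (sval E `|` sval F) (measurableU _ _ (svalP E) (svalP F)).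
Definition nr_neg (E : B) : B :=
  exist _ (~` sval E) (measurableC (svalP E)).

Let nr_inhabited : inhabited K.
Proof.
have [//|a Ka _] := @nr_witness _ _ _ N 0 (FEq (TVar L ord0) (TVar L ord0))
  (@snil (Omega -> M)) _; first by case.
by constructor; exists a.
Qed.

Let measurable_neq (a b : K) : measurable [set w | sval a w <> sval b w].
Proof.
pose ab := scons a (scons b (@snil K)).
have := svalP (nr_evt (FNot (FEq (TVar L 0) (TVar L 1))) ab).
rewrite /= /event/= /ab /scons unlift_none.
by rewrite (_ : 1 = lift ord0 ord0) ?liftK ?unlift_none//; apply/val_inj.
Qed.

Let nr_dB_pseudometric : pseudometric01 nr_dB.
Proof.
split=> [E F|E F|E|E F|[E mE] [F mF] [G mG]]; rewrite /nr_dB.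
- exact: pr_ge0.
- by apply: pr_le1; apply: measurableY; exact: svalP.
- by rewrite setYK pr0.
- by rewrite setYC.
- apply: pr_subU => /=; [exact: measurableY..|] => w/=.
  by have [|] := pselect (F w); tauto.
Qed.

Let nr_dK_pseudometric : pseudometric01 nr_dK.
Proof.
split=> [a b|a b|a|a b|a b c]; rewrite /nr_dK.
- exact: pr_ge0.
- exact/pr_le1/measurable_neq.
- by rewrite (_ : [set _ | _] = set0)// ?pr0//; apply/seteqP; split=> w.
- by congr pr; apply/seteqP; split => w /= /nesym.
- apply: pr_subU; [exact: measurable_neq..|] => w /= ac.
  by have [ab|] := pselect (sval a w = sval b w); [right; rewrite -ab|left].
Qed.

Let nr_mu_lipschitz (E F : B) : `|pr (sval E) - pr (sval F)| <= nr_dB E F.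
Proof.
case: E F => [E mE] [F mF]; rewrite /nr_dB/= ler_norml lerBlDr lerNl opprB.
rewrite lerBlDr; apply/andP; split.
  apply: pr_subU => //; first exact: measurableY.
  by move=> w/=; have [|] := pselect (E w); tauto.
apply: pr_subU => //; first exact: measurableY.
by move=> w/=; have [|] := pselect (F w); tauto.
Qed.

Let nr_evt_lipschitz n (phi : formula L n) (a b : 'I_n -> K) :
  nr_dB (nr_evt phi a) (nr_evt phi b) <= \sum_(i < n) nr_dK (a i) (b i).
Proof.
apply: pr_sub_sum => [|i|w /= abw].
- exact: measurableY (svalP (nr_evt phi a)) (svalP (nr_evt phi b)).
- exact: measurable_neq.
- apply: contrapT => eq_ab.
  have {}eq_ab : (fun i => sval (a i) w) = (fun i => sval (b i) w).
    by apply/funext => i; apply: contrapT => ne; apply: eq_ab; exists i.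
  by move: abw; rewrite /event/= eq_ab; tauto.
Qed.

Let nr_cap_lipschitz (E E' F F' : B) :
  nr_dB (nr_cap E F) (nr_cap E' F') <= nr_dB E E' + nr_dB F F'.
Proof.
apply: pr_subU; [exact: measurableY (svalP _) (svalP _)..|] => w/=.
by have [|] := pselect (sval E w); have [|] := pselect (sval F w);
   have [|] := pselect (sval E' w); have [|] := pselect (sval F' w); tauto.
Qed.

Let nr_cup_lipschitz (E E' F F' : B) :
  nr_dB (nr_cup E F) (nr_cup E' F') <= nr_dB E E' + nr_dB F F'.
Proof.
apply: pr_subU; [exact: measurableY (svalP _) (svalP _)..|] => w/=.
by have [|] := pselect (sval E w); have [|] := pselect (sval F w);
   have [|] := pselect (sval E' w); have [|] := pselect (sval F' w); tauto.
Qed.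

Let nr_neg_lipschitz (E E' : B) :
  nr_dB (nr_neg E) (nr_neg E') <= nr_dB E E'.
Proof.
apply: le_pr; [exact: measurableY (svalP _) (svalP _)..|] => w/=.
by have [|] := pselect (sval E w); have [|] := pselect (sval E' w); tauto.
Qed.

Definition nr_prestructure : prestructure R L := {|
  sortK := K;
  sortB := B;
  evt := nr_evt;
  mu := fun E => pr (sval E);
  btop := nr_top;
  bbot := nr_bot;
  bcap := nr_cap;
  bcup := nr_cup;
  bneg := nr_neg;
  dB := nr_dB;
  dK := nr_dK;
  sortK_inhabited := nr_inhabited;
  dB_pseudometric := nr_dB_pseudometric;
  dK_pseudometric := nr_dK_pseudometric;
  mu_ge0 := fun E => pr_ge0 (sval E);
  mu_le1 := fun E => pr_le1 (svalP E);
  mu_lipschitz := nr_mu_lipschitz;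
  evt_lipschitz := nr_evt_lipschitz;
  bcap_lipschitz := nr_cap_lipschitz;
  bcup_lipschitz := nr_cup_lipschitz;
  bneg_lipschitz := nr_neg_lipschitz
|}.

End NicePrestructure.

Definition randomization_theory (R : realType) (L : signature) (T : theory L) :
    set (cformula R L 0 0) :=
  [set Phi | forall M : structure L, fomodel T M ->
     forall N : nice_randomization R M, ctrue (nr_prestructure N) Phi].

Definition randomization_model (R : realType) (L : signature) (T : theory L)
    (N : prestructure R L) : Prop :=
  is_structure N /\ forall Phi, randomization_theory T Phi -> ctrue N Phi.

Definition definable_over (R : realType) (L : signature) (N : prestructure R L)
    (A : set (sortK N)) (b : sortK N) : Prop :=
  exists (n : nat -> nat) (Phi : forall k, cformula R L (n k).+1 0)
      (a : forall k, 'I_(n k) -> sortK N),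
    (forall k i, A (a k i)) /\
    (forall e : R, 0 < e -> \forall k \near \oo, forall x : sortK N,
       `|cvalue (Phi k) (scons x (a k)) (@snil (sortB N)) - dK x b| < e).

Definition dcl (R : realType) (L : signature) (N : prestructure R L)
    (A : set (sortK N)) : set (sortK N) :=
  [set b | definable_over A b].

Definition fdcl (R : realType) (L : signature) (T : theory L)
    (N : prestructure R L) (A : set (sortK N)) : set (sortK N) :=
  [set b | exists n (phi : formula L n.+1) (a : 'I_n -> sortK N),
     [/\ functional T phi, forall i, A (a i) &
         evt N phi (scons b a) = btop N]].

Definition metric_closure (R : realType) (L : signature) (N : prestructure R L)
    (S : set (sortK N)) : set (sortK N) :=
  [set b | forall e : R, 0 < e -> exists2 c, S c & dK c b < e].

(* Main.v *)
Require Import Defs.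
From mathcomp Require Import all_boot all_order all_algebra.
From mathcomp Require Import all_classical all_reals all_analysis.
From mathcomp Require Import lra.
Import Order.TTheory GRing.Theory Num.Theory.
Import numFieldNormedType.Exports.
Local Open Scope classical_set_scope.
Local Open Scope ring_scope.

(* In a nice randomization quantifiers can be eliminated exactly: since the
   space is atomless, a finite-valued random variable can be copied next to any
   other tuple with the same law, so the value of a continuous formula
   Phi(x, a) depends only on the joint law of finitely many events [[phi(x, a)]].
   Given b, resample the (finite) type of b over a independently, and whenever a
   type has several realizations move away from b.  This produces x with
   Phi(x, a) = Phi(b, a) such that d(x, b) dominates the measure of the
   complement of [[phi(b, a)]] for one of finitely many functional formulas
   phi, which depend only on Phi.  Phrased as a sentence of T^R, this transfers
   to N: if Phi(., a) is uniformly close to d(., b), then d(x, b) is small,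
   hence [[phi(b, a)]] is almost everything and b is close to a first-order
   definable element.  Conversely, if phi is functional and [[phi(c, a)]] is
   everything, then d(x, c) is exactly the distance from [[phi(x, a)]] to the
   top event. *)

Set Implicit Arguments.
Unset Strict Implicit.
Unset Printing Implicit Defensive.

(** * First-order definability *)

Lemma scons0 (X : Type) n (x : X) (v : 'I_n -> X) : scons x v ord0 = x.
Proof. by rewrite /scons unlift_none. Qed.

Lemma scons_lift (X : Type) n (x : X) (v : 'I_n -> X) i :
  scons x v (lift ord0 i) = v i.
Proof. by rewrite /scons liftK. Qed.

Lemma scons_eta (X : Type) n (v : 'I_n.+1 -> X) :
  scons (v ord0) (fun i => v (lift ord0 i)) = v.
Proof.
apply/funext => i; case: (unliftP ord0 i) => [j ->|->].
  by rewrite scons_lift.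
by rewrite scons0.
Qed.

Lemma comp_scons (X Y : Type) n (g : X -> Y) (x : X) (v : 'I_n -> X) :
  (fun i => g (scons x v i)) = scons (g x) (fun i => g (v i)).
Proof.
apply/funext => i; case: (unliftP ord0 i) => [j ->|->].
  by rewrite !scons_lift.
by rewrite !scons0.
Qed.

Lemma snil_eq (X : Type) (v : 'I_0 -> X) : v = @snil X.
Proof. by apply/funext => -[]. Qed.

Section Definability.
Variable L : signature.

Fixpoint tren n m (f : 'I_n -> 'I_m) (t : term L n) : term L m :=
  match t with
  | TVar i => TVar L (f i)
  | TFun g ts => TFun (fun j => tren f (ts j))
  end.

Definition upren n m (f : 'I_n -> 'I_m) : 'I_n.+1 -> 'I_m.+1 :=
  scons ord0 (fun i => lift ord0 (f i)).

Fixpoint fren n (phi : formula L n) : forall m, ('I_n -> 'I_m) -> formula L m :=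
  match phi in formula _ n return forall m, ('I_n -> 'I_m) -> formula L m with
  | FEq _ t s => fun m f => FEq (tren f t) (tren f s)
  | FRel _ r ts => fun m f => FRel (fun j => tren f (ts j))
  | FNot _ psi => fun m f => FNot (fren psi f)
  | FAnd _ psi chi => fun m f => FAnd (fren psi f) (fren chi f)
  | FEx _ psi => fun m f => FEx (fren psi (upren f))
  end.

Lemma teval_tren (M : structure L) n m (f : 'I_n -> 'I_m) (t : term L n)
  (v : 'I_m -> M) : teval (tren f t) v = teval t (fun i => v (f i)).
Proof.
by elim: t => [//|g ts IH] /=; congr finterp; apply/funext => j; exact: IH.
Qed.

Lemma satisfies_fren (M : structure L) n (phi : formula L n) m
  (f : 'I_n -> 'I_m) (v : 'I_m -> M) :
  satisfies (fren phi f) v <-> satisfies phi (fun i => v (f i)).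
Proof.
elim: phi m f v => [{}n t s|{}n r ts|{}n psi IH|{}n psi IHp chi IHc|{}n psi IH]
  m f v /=.
- by rewrite !teval_tren.
- rewrite (_ : (fun j => _) = (fun j => teval (ts j) (fun i => v (f i)))) //.
  by apply/funext => j; rewrite teval_tren.
- by rewrite IH.
- by rewrite IHp IHc.
- have E x : (fun i => scons x v (upren f i)) = scons x (fun i => v (f i)).
    by rewrite /upren comp_scons scons0; congr scons; apply/funext => i;
       rewrite scons_lift.
  by split=> -[x]; [move/IH|move=> H; exists x; apply/IH; move: H];
     rewrite E => // H; exists x.
Qed.

(* Formulas are handled through the relations that they define uniformly in
   all structures. *)
Definition fodef n (Q : forall M : structure L, ('I_n -> M) -> Prop) :=
  exists phi : formula L n, forall M v, satisfies phi v <-> Q M v.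

Lemma fodef_ext n (Q Q' : forall M : structure L, ('I_n -> M) -> Prop) :
  (forall M v, Q M v <-> Q' M v) -> fodef Q -> fodef Q'.
Proof.
by move=> QQ' [phi H]; exists phi => M v; rewrite H; exact: QQ'.
Qed.

Lemma fodef_formula n (phi : formula L n) :
  fodef (fun M (v : 'I_n -> M) => satisfies phi v).
Proof. by exists phi. Qed.

Lemma fodef_eq n (i j : 'I_n) : fodef (fun M (v : 'I_n -> M) => v i = v j).
Proof. by exists (FEq (TVar L i) (TVar L j)). Qed.

Lemma fodef_not n (Q : forall M : structure L, ('I_n -> M) -> Prop) :
  fodef Q -> fodef (fun M v => ~ Q M v).
Proof. by move=> [phi H]; exists (FNot phi) => M v /=; rewrite H. Qed.

Lemma fodef_and n (Q Q' : forall M : structure L, ('I_n -> M) -> Prop) :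
  fodef Q -> fodef Q' -> fodef (fun M v => Q M v /\ Q' M v).
Proof.
by move=> [phi H] [psi H']; exists (FAnd phi psi) => M v /=; rewrite H H'.
Qed.

Lemma fodef_or n (Q Q' : forall M : structure L, ('I_n -> M) -> Prop) :
  fodef Q -> fodef Q' -> fodef (fun M v => Q M v \/ Q' M v).
Proof.
move=> dQ dQ'.
apply: (fodef_ext _ (fodef_not (fodef_and (fodef_not dQ) (fodef_not dQ')))).
by move=> M v; have [] := pselect (Q M v); have [] := pselect (Q' M v); tauto.
Qed.

Lemma fodef_ex n (Q : forall M : structure L, ('I_n.+1 -> M) -> Prop) :
  fodef Q -> fodef (fun M (v : 'I_n -> M) => exists x : M, Q M (scons x v)).
Proof.
move=> [phi H]; exists (FEx phi) => M v /=.
by split=> -[x /H Hx]; exists x.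
Qed.

Lemma fodef_ren n m (f : 'I_n -> 'I_m)
  (Q : forall M : structure L, ('I_n -> M) -> Prop) :
  fodef Q -> fodef (fun M (v : 'I_m -> M) => Q M (fun i => v (f i))).
Proof.
by move=> [phi H]; exists (fren phi f) => M v; rewrite satisfies_fren H.
Qed.

Lemma fodef_const n (b : Prop) : fodef (fun M (v : 'I_n -> M) => b).
Proof.
(* With [n = 0] there is no variable to form an equation with, so truth is written as
   [exists x, x = x], which relies on structures being inhabited. *)
have [phi phiT] : fodef (fun M (v : 'I_n -> M) => True).
  apply: (fodef_ext _ (fodef_ex (fodef_eq (@ord0 n) ord0))) => M v.
  by split=> // _; have [x] := dom_inhabited M; exists x.
have [Hb|Hb] := pselect b; first by exists phi => M v; rewrite phiT; tauto.
by exists (FNot phi) => M v /=; rewrite phiT; tauto.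
Qed.

Lemma fodef_fin_ex n (X : finType)
  (Q : X -> forall M : structure L, ('I_n -> M) -> Prop) :
  (forall x, fodef (Q x)) -> fodef (fun M v => exists x, Q x M v).
Proof.
move=> dQ.
suff H (s : seq X) : fodef (fun M v => exists2 x, x \in s & Q x M v).
  apply: (fodef_ext _ (H (enum X))) => M v.
  by split=> [[x _]|[x]] Hx; exists x => //; rewrite mem_enum.
elim: s => [|y s IH].
  by apply: (fodef_ext _ (fodef_const n False)) => M v; split => // -[].
apply: (fodef_ext _ (fodef_or (dQ y) IH)) => M v.
split=> [[Qy|[x xs Qx]]|[x]].
- by exists y; rewrite ?mem_head.
- by exists x; rewrite // inE xs orbT.
- by rewrite inE => /orP[/eqP -> Qy|xs Qx]; [left|right; exists x].
Qed.

(** Such an [F] plays the part of a finite type: its fibres cut the tuples into finitely many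
    first-order pieces, by the same formulas in every structure. *)
Definition fdef n (X : finType) (F : forall M : structure L, ('I_n -> M) -> X) :=
  forall x, fodef (fun M v => F M v = x).

Lemma fdef_pred n (X : finType) (F : forall M : structure L, ('I_n -> M) -> X)
  (Q : X -> Prop) : fdef F -> fodef (fun M v => Q (F M v)).
Proof.
move=> dF; have H x : fodef (fun M (v : 'I_n -> M) => Q x /\ F M v = x).
  by apply: fodef_and => //; exact: fodef_const.
apply: (fodef_ext _ (fodef_fin_ex H)) => M v.
by split=> [[x [Qx ->]]|QF] //; exists (F M v).
Qed.

(** The set equals [S] unless some [x] is misclassified, and ruling this out is a finite Boolean
    combination of the [Q x]. *)
Lemma fdef_set n (X : finType)
  (Q : X -> forall M : structure L, ('I_n -> M) -> Prop) :
  (forall x, fodef (Q x)) ->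
  fdef (fun M v => [set x | `[< Q x M v >]]%SET).
Proof.
move=> dQ S.
have H x : fodef (fun M (v : 'I_n -> M) => ~ (Q x M v <-> x \in S)).
  case: (x \in S).
    apply: (fodef_ext _ (fodef_not (dQ x))) => M v.
    by split=> [nQ [_ /(_ isT)]//|nH Qx]; apply: nH.
  apply: (fodef_ext _ (dQ x)) => M v.
  by split=> [Qx [/(_ Qx)]//|nH]; apply: contrapT => nQ; apply: nH.
apply: (fodef_ext _ (fodef_not (fodef_fin_ex H))) => M v.
split=> [nH|<- [x]].
  apply/setP => x; rewrite inE; apply/idP/idP.
    by move/asboolP=> Qx; apply: contrapT => nx; apply: nH; exists x => -[/(_ Qx)].
  by move=> xS; apply/asboolP; apply: contrapT => nQ; apply: nH;
     exists x => -[_ /(_ xS)].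
by rewrite inE; apply; split => /asboolP.
Qed.

End Definability.

(** * Atomless probability spaces *)

Section Splitting.
Variables (d : measure_display) (Om : measurableType d) (R : realType).
Variable P : probability Om R.

Definition pr (E : set Om) : R := fine (P E).

Lemma prE E : measurable E -> (pr E)%:E = P E.
Proof. by move=> mE; rewrite /pr fineK// fin_num_measure. Qed.

Lemma pr_ge0 E : 0 <= pr E.
Proof. by rewrite fine_ge0. Qed.

Lemma pr_set0 : pr set0 = 0.
Proof. by rewrite /pr measure0. Qed.

Lemma pr_setT : pr setT = 1.
Proof. by rewrite /pr probability_setT. Qed.

Lemma le_pr E F : measurable E -> measurable F -> E `<=` F -> pr E <= pr F.
Proof. by move=> mE mF EF; rewrite -lee_fin !prE// le_measure// inE. Qed.

Lemma prU E F : measurable E -> measurable F -> E `&` F = set0 ->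
  pr (E `|` F) = pr E + pr F.
Proof.
move=> mE mF EF; apply: EFin_inj.
rewrite EFinD !prE//; last exact: measurableU.
by rewrite measureU.
Qed.

Lemma prD E F : measurable E -> measurable F -> E `<=` F ->
  pr (F `\` E) = pr F - pr E.
Proof.
move=> mE mF EF; apply/eqP; rewrite eq_sym subr_eq; apply/eqP.
by rewrite addrC -prU ?setDUK ?setDIK//; exact: measurableD.
Qed.

Lemma pr_setC E : measurable E -> pr (~` E) = 1 - pr E.
Proof. by move=> mE; rewrite -setTD prD// pr_setT. Qed.

Lemma le_prU E F G : measurable E -> measurable F -> measurable G ->
  E `<=` F `|` G -> pr E <= pr F + pr G.
Proof.
move=> mE mF mG EFG; apply: (@le_trans _ _ (pr (F `|` G))).
  by apply: le_pr => //; exact: measurableU.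
by rewrite -lee_fin EFinD !prE//; [exact: measureU2|exact: measurableU].
Qed.

Lemma pr_subset0 E F : measurable E -> measurable F -> E `<=` F ->
  pr F = 0 -> pr E = 0.
Proof.
by move=> mE mF EF F0; apply/eqP; rewrite eq_le pr_ge0 -F0 le_pr.
Qed.

Lemma pr_bigcup_lim (F : nat -> set Om) :
  (forall n, measurable (F n)) -> (forall n, F n `<=` F n.+1) ->
  (pr \o F) @ \oo --> pr (\bigcup_n F n).
Proof.
move=> mF incF; apply: fine_cvg; rewrite prE; last exact: bigcup_measurable.
apply: nondecreasing_cvg_mu => //; first exact: bigcup_measurable.
by apply: homo_leq => [E|E F' G|n]; rewrite ?subsetEset//; apply: subset_trans.
Qed.

Hypothesis P_atomless : atomless P.

(** Atomlessness splits a set into two parts of positive measure. Keeping the smaller part at least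
    halves the measure, and iteration brings it below [e]. *)
Lemma small_subset E (e : R) : measurable E -> 0 < pr E -> 0 < e ->
  exists F, [/\ measurable F, F `<=` E, 0 < pr F & pr F <= e].
Proof.
move=> mE E0 e0.
have H n : exists F, [/\ measurable F, F `<=` E, 0 < pr F &
    pr F <= pr E / 2 ^+ n].
  elim: n => [|n [F [mF FE F0 Fn]]].
    by exists E; split => //; rewrite expr0 divr1.
  have [|G [mG GF]] := P_atomless mF; first by rewrite -prE// lte_fin.
  rewrite -!prE// !lte_fin => G0 GltF.
  rewrite exprS invfM mulrCA.
  have [Gle|Ggt] := leP (pr G) (2^-1 * (pr E / 2 ^+ n)).
    by exists G; split => //; apply: subset_trans GF FE.
  exists (F `\` G); split; first exact: measurableD.
  - by move=> w [/FE].
  - by rewrite prD// subr_gt0.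
  - rewrite prD//; lra.
have [n ne] : exists n, pr E / e < 2 ^+ n.
  exists (Num.bound (pr E / e)).
  apply: (lt_le_trans (archi_boundP _)); first by rewrite divr_ge0// ltW.
  by rewrite -natrX ler_nat ltnW// ltn_expl.
have [F [mF FE F0 Fn]] := H n; exists F; split => //.
apply: (le_trans Fn); rewrite ler_pdivrMr ?exprn_gt0//.
by rewrite mulrC -ler_pdivrMr// ltW.
Qed.

(** Sierpinski's theorem. A greedy increasing sequence of subsets of measure at most [t] has a union
    that cannot be enlarged within this bound; if its measure were less than [t], a small subset of
    the remainder could still be added. *)
Lemma sierpinski_subset C (t : R) : measurable C -> 0 <= t <= pr C ->
  exists F, [/\ measurable F, F `<=` C & pr F = t].
Proof.
move=> mC /andP[t0 tC].
pose valid F := [/\ measurable F, F `<=` C & pr F <= t].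
(* Each step gains at least half of the measure that can still be gained. *)
have step F : exists F', valid F -> [/\ valid F', F `<=` F' &
    forall H, valid H -> F `<=` H -> pr H <= 2 * pr F' - pr F].
  have [vF|nvF] := pselect (valid F); last by exists F => /nvF.
  pose A := [set pr H | H in [set H | valid H /\ F `<=` H]].
  have ubA : has_ubound A by exists t => _ [H [[]]] _ _ Ht _ <-.
  have AF : A (pr F) by exists F => //; split.
  have leF : pr F <= sup A by apply: ub_le_sup.
  have leA G : valid G -> F `<=` G -> pr G <= sup A.
    by move=> vG FG; apply: ub_le_sup => //; exists G.
  have [eqF|neF] := eqVneq (pr F) (sup A).
    by exists F; split => // G vG FG; have := leA G vG FG; lra.
  have e0 : 0 < (sup A - pr F) / 2 by rewrite divr_gt0// subr_gt0 lt_neqAle neF.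
  have [|_ [F' [vF' FF'] <-] ltF'] := @sup_adherent _ A _ e0.
    by split => //; exists (pr F).
  by exists F' => _; split => // G vG FG; have := leA G vG FG; lra.
have [next nextP] := choice step.
pose G n := iter n next set0.
have vG n : valid (G n).
  elim: n => [|n /nextP[]//].
  by split => //=; rewrite pr_set0.
have incG n : G n `<=` G n.+1 by have [] := nextP _ (vG n).
have mG n : measurable (G n) by have [] := vG n.
pose F := \bigcup_n G n.
have mF : measurable F by exact: bigcup_measurable.
have FC : F `<=` C by move=> w [n _]; have [_ + _] := vG n; apply.
have cvgG := pr_bigcup_lim mG incG.
have Ft : pr F <= t.
  rewrite -(cvg_lim _ cvgG)//; apply: limr_le; first by apply/cvg_ex; exists (pr F).
  by apply: nearW => n; have [] := vG n.
have maxF H : valid H -> F `<=` H -> pr H <= pr F.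
  move=> vH FH.
  (* The inequality for the gain of one step passes to the limit, where both [pr (G n.+1)] and
     [pr (G n)] become [pr F]. *)
  have cvg2 : (fun n => 2 * pr (G n.+1) - pr (G n)) @ \oo --> pr F.
    have -> : pr F = 2 * pr F - pr F by lra.
    apply: cvgB => //; apply: cvgM; first exact: cvg_cst.
    by move: cvgG; rewrite -(cvg_shiftS (pr \o G)).
  rewrite -(cvg_lim _ cvg2)//; apply: limr_ge; first by apply/cvg_ex; exists (pr F).
  apply: nearW => n; have [_ _] := nextP _ (vG n); apply => //.
  by move=> w Gw; apply: FH; exists n.
exists F; split => //; apply/eqP; rewrite eq_le Ft/= leNgt; apply/negP => ltF.
have mCF : measurable (C `\` F) by exact: measurableD.
have [|||E [mE ECF E0 Et]] := @small_subset (C `\` F) (t - pr F) => //.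
- by rewrite prD// subr_gt0; exact: lt_le_trans ltF tC.
- by rewrite subr_gt0.
have FE0 : F `&` E = set0 by apply/seteqP; split=> // w [Fw /ECF[_ /(_ Fw)]].
have := maxF (F `|` E); rewrite prU//.
have vFE : valid (F `|` E).
  split; [exact: measurableU|by move=> w [/FC//|/ECF[]]|by rewrite prU//; lra].
by move=> /(_ vFE (@subsetUl _ _ _)); lra.
Qed.


(** * Finite-valued random variables and their laws *)

Definition mfin (X : finType) (f : Om -> X) :=
  forall x, measurable [set w | f w = x].

Lemma mfin_pred (X : finType) (f : Om -> X) (Q : X -> Prop) :
  mfin f -> measurable [set w | Q (f w)].
Proof.
move=> mf; rewrite (_ : [set _ | _] =
  \bigcup_(x in [set x | Q x]) [set w | f w = x]).
  by apply: fin_bigcup_measurable.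
by apply/seteqP; split=> [w Qw|w [x Qx /= ->]//]; exists (f w).
Qed.

Lemma mfin_comp (X Y : finType) (f : Om -> X) (k : X -> Y) :
  mfin f -> mfin (k \o f).
Proof. by move=> mf y; exact: (mfin_pred (fun x => k x = y)). Qed.

Lemma mfin_dep (X Y : finType) (f : Om -> X) (h : X -> Om -> Y) :
  mfin f -> (forall x, mfin (h x)) -> mfin (fun w => h (f w) w).
Proof.
move=> mf mh y; rewrite (_ : [set _ | _] =
  \bigcup_(x in setT) ([set w | f w = x] `&` [set w | h x w = y])).
  apply: fin_bigcup_measurable => // x _.
  by apply: measurableI; [exact: mf|exact: mh].
by apply/seteqP; split=> [w /= hw|w [x _ [/= -> ->]]//]; exists (f w).
Qed.

Lemma mfin_pair (X Y : finType) (f : Om -> X) (g : Om -> Y) :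
  mfin f -> mfin g -> mfin (fun w => (f w, g w)).
Proof.
move=> mf mg; apply: (mfin_dep (h := fun x w => (x, g w)) mf) => x.
exact: (mfin_comp (fun y => (x, y)) mg).
Qed.

Lemma mfin_bool (E : set Om) : measurable E -> mfin (fun w => `[< E w >]).
Proof.
move=> mE [].
  rewrite (_ : [set _ | _] = E)//.
  by apply/seteqP; split=> w /= => [/asboolP|Ew]//; exact/asboolP.
rewrite (_ : [set _ | _] = ~` E); first exact: measurableC.
by apply/seteqP; split=> w /= => [/asboolPn//|nE]; exact/asboolPn.
Qed.

Lemma pr_fin (X : finType) (f : Om -> X) (E : set Om) :
  measurable E -> mfin f ->
  pr E = \sum_x pr (E `&` [set w | f w = x]).
Proof.
move=> mE mf.
have mI Q : measurable (E `&` [set w | Q (f w)]).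
  by apply: measurableI => //; exact: (mfin_pred Q).
have H (s : seq X) : uniq s -> pr (E `&` [set w | f w \in s]) =
    \sum_(x <- s) pr (E `&` [set w | f w = x]).
  elim: s => [_|x s IH /= /andP[xs us]].
    rewrite big_nil (_ : _ `&` _ = set0) ?pr_set0//.
    by apply/seteqP; split=> // w [_].
  rewrite big_cons -IH// -prU; [|exact: (mI (fun y => y = x))|
    exact: (mI (fun y => y \in s))|].
    congr pr; apply/seteqP; split=> w /=.
      by rewrite inE => -[Ew /orP[/eqP|]]; [left|right].
    by case=> -[Ew H]; split=> //; rewrite inE H ?eqxx// orbT.
  by apply/seteqP; split=> // w [[_ /= ->] [_]]/=; rewrite (negbTE xs).
rewrite -big_enum -H ?enum_uniq//; congr pr.
by apply/seteqP; split=> [w Ew|w []//]; split=> //=; rewrite mem_enum.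
Qed.

Definition samelaw (X : finType) (f f' : Om -> X) :=
  forall x, pr [set w | f w = x] = pr [set w | f' w = x].

Lemma samelaw_sym (X : finType) (f f' : Om -> X) :
  samelaw f f' -> samelaw f' f.
Proof. by move=> ff' x. Qed.

Lemma samelaw_pred (X : finType) (f f' : Om -> X) (Q : X -> Prop) :
  mfin f -> mfin f' -> samelaw f f' ->
  pr [set w | Q (f w)] = pr [set w | Q (f' w)].
Proof.
move=> mf mf' ff'.
rewrite (pr_fin _ mf); last exact: mfin_pred.
rewrite (pr_fin _ mf'); last exact: mfin_pred.
apply: eq_bigr => x _.
have E (k : Om -> X) : [set w | Q (k w)] `&` [set w | k w = x] =
    if pselect (Q x) then [set w | k w = x] else set0.
  by case: pselect => Qx; apply/seteqP; split=> [w [/= Qk kx]|w /= kx];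
    rewrite ?kx//; move: Qk; rewrite kx.
by rewrite !E; case: pselect => // Qx; exact: ff'.
Qed.

Lemma samelaw_comp (X Y : finType) (k : X -> Y) (f f' : Om -> X) :
  mfin f -> mfin f' -> samelaw f f' -> samelaw (k \o f) (k \o f').
Proof.
by move=> mf mf' ff' y; exact: (samelaw_pred (fun x => k x = y)).
Qed.

Lemma samelaw_ae (X : finType) (f f' : Om -> X) (E : set Om) : mfin f -> mfin f' ->
  measurable E -> pr E = 0 -> (forall w, ~ E w -> f w = f' w) -> samelaw f f'.
Proof.
move=> mf mf' mE E0 ff' x.
suff le (g g' : Om -> X) : mfin g -> mfin g' -> (forall w, ~ E w -> g w = g' w) ->
    pr [set w | g w = x] <= pr [set w | g' w = x].
  apply/eqP; rewrite eq_le; apply/andP; split; first exact: le.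
  by apply: le => // w nEw; rewrite ff'.
move=> mg mg' gg'.
have -> : pr [set w | g' w = x] =
    pr [set w | g' w = x] + pr (E `\` [set w | g' w = x]).
  rewrite (@pr_subset0 (E `\` [set w | g' w = x]) E) ?addr0//.
  exact: measurableD.
rewrite -prU//; [|exact: measurableD|by rewrite setDIK].
apply: le_pr => //; first by apply: measurableU => //; exact: measurableD.
move=> w /= gx; have [Ew|nEw] := pselect (E w); last by left; rewrite -gg'.
by have [|] := pselect (g' w = x); [left|right].
Qed.

(** Induction on a list of values outside which the weights vanish: a piece of measure [p y] is cut
    off from [C], and the other values share the rest. *)
Lemma exists_fin_pr (Y : finType) (y0 : Y) (C : set Om) (p : Y -> R) :
  measurable C -> (forall y, 0 <= p y) -> \sum_y p y = pr C ->
  exists h : Om -> Y, mfin h /\ forall y, pr (C `&` [set w | h w = y]) = p y.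
Proof.
move=> mC p0; rewrite -big_enum.
have : forall y, y \notin enum Y -> p y = 0 by move=> y; rewrite mem_enum.
elim: (enum Y) (enum_uniq Y) C p mC p0 => [_|y s IH /= /andP[ys us]] C p mC p0 ps.
  (* With no value left [C] is null, so the constant [y0] will do. *)
  rewrite big_nil => C0; exists (fun=> y0); split.
    by move=> y; apply: (mfin_pred (f := fun=> tt) (fun=> y0 = y)) => -[];
      rewrite (_ : [set _ | _] = setT)//; exact/seteqP.
  move=> y; rewrite ps//; apply: (@pr_subset0 _ C) => //.
  apply: measurableI => //; have [->|ne] := eqVneq y0 y.
    by rewrite (_ : [set _ | _] = setT)//; exact/seteqP.
  by rewrite (_ : [set _ | _] = set0)//; apply/seteqP; split=> // w /= E; move: ne;
    rewrite E eqxx.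
rewrite big_cons => sumC.
have [|F [mF FC prF]] := @sierpinski_subset C (p y) mC.
  by rewrite p0/= -sumC lerDl sumr_ge0.
(* The weight of the value just treated is reset to 0, so that the weights again vanish outside the
   shorter list. *)
pose p' z := if z == y then 0 else p z.
have p'E z : z \in s -> p' z = p z.
  by move=> zs; rewrite /p'; case: eqP => // E; rewrite -E zs in ys.
have [||||h [mh hp]] := IH us (C `\` F) p'.
- exact: measurableD.
- by move=> z; rewrite /p'; case: ifP.
- by move=> z zs; rewrite /p'; case: ifPn => // zy; apply: ps;
    rewrite inE negb_or zy.
- rewrite prD// prF -sumC addrAC subrr add0r.
  by rewrite big_seq [RHS]big_seq; apply: eq_bigr => z /p'E.
pose h' w := if `[< F w >] then y else h w.
have mh' : mfin h'.
  by apply: (mfin_dep (f := fun w => `[< F w >])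
    (h := fun b w => if b then y else h w)); [exact: mfin_bool|case=> //;
    exact: (mfin_comp (fun=> y) mh)].
exists h'; split=> // z.
have [->|zy] := eqVneq z y.
  rewrite -prF.
  have -> : C `&` [set w | h' w = y] = F `|` ((C `\` F) `&` [set w | h w = y]).
    apply/seteqP; rewrite /h'; split=> w /=.
      by case=> Cw; case: asboolP => Fw H; [left|right].
    by case=> [Fw|[[Cw nF] H]]; case: asboolP => //; split=> //; exact: FC.
  rewrite prU//; first by rewrite hp /p' eqxx addr0.
    by apply: measurableI; [exact: measurableD|exact: mh].
  by rewrite setIA setDIK set0I.
have -> : C `&` [set w | h' w = z] = (C `\` F) `&` [set w | h w = z].
  apply/seteqP; rewrite /h'; split=> w /=; case: asboolP => Fw.
  - by move=> [Cw E]; rewrite E eqxx in zy.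
  - by move=> [Cw E].
  - by move=> [[]].
  - by move=> [[Cw _] E].
by rewrite hp /p' (negbTE zy).
Qed.

(** On each fibre of [f'] the masses that [g] has on the corresponding fibre of [f] are realized;
    they fit since the two fibres have the same measure. This is the source of all back-and-forth
    steps. *)
Lemma samelaw_extend (X Y : finType) (f f' : Om -> X) (g : Om -> Y) :
  mfin f -> mfin f' -> mfin g -> samelaw f f' ->
  exists g' : Om -> Y, mfin g' /\
    samelaw (fun w => (f w, g w)) (fun w => (f' w, g' w)).
Proof.
move=> mf mf' mg ff'.
have H x : exists h : Om -> Y, mfin h /\ forall y,
    pr ([set w | f' w = x] `&` [set w | h w = y]) =
    pr ([set w | f w = x] `&` [set w | g w = y]).
  (* [point] is a default sample; [g point] only shows that [Y] is inhabited. *)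
  apply: (exists_fin_pr (g point)) => [|y|]; first exact: mf'.
    exact: pr_ge0.
  by rewrite -ff' -pr_fin//; exact: mf.
have [h hP] := choice H.
exists (fun w => h (f' w) w); split.
  by apply: mfin_dep => // x; have [] := hP x.
move=> [x y].
have E (k : Om -> X) (k' : Om -> Y) : [set w | (k w, k' w) = (x, y)] =
    [set w | k w = x] `&` [set w | k' w = y].
  by apply/seteqP; split=> w /= [-> ->].
rewrite !E -(hP x).2; congr pr.
by apply/seteqP; split=> w /= [-> ->].
Qed.

(* [g'] is a copy of [g] that is independent of [g] conditionally on [f]; the
   inequality is then [\sum_y m_y ^ 2 / m <= max m_y] with
   [m_y = P(f = x, g = y)] and [m = P(f = x)]. *)
Lemma independent_copy (X Y : finType) (f : Om -> X) (g : Om -> Y) :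
  mfin f -> mfin g ->
  exists (g' : Om -> Y) (c : X -> Y), [/\ mfin g',
    samelaw (fun w => (f w, g w)) (fun w => (f w, g' w)) &
    forall x, pr ([set w | f w = x] `&` [set w | g w = g' w]) <=
              pr ([set w | f w = x] `&` [set w | g w = c x])].
Proof.
move=> mf mg.
pose C x := [set w | f w = x].
pose m x y := pr (C x `&` [set w | g w = y]).
have mC x y : measurable (C x `&` [set w | g w = y]).
  by apply: measurableI; [exact: mf|exact: mg].
have m0 x y : 0 <= m x y by exact: pr_ge0.
have summ x : \sum_y m x y = pr (C x) by rewrite -pr_fin//; exact: mf.
have mle x y : m x y <= pr (C x) by apply: le_pr => //; exact: mf.
(* On a null fibre the quotient is taken by 0, which is harmless because [m x y] vanishes there
   too. *)
have mK x y : m x y * pr (C x) / pr (C x) = m x y.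
  have [E0|/mulfK->//] := eqVneq (pr (C x)) 0.
  by apply/eqP; rewrite E0 mulr0 mul0r eq_le m0 -E0 mle.
(* Where [f = x] and [g = y], the copy takes the value [z] with the conditional probability of
   [g = z] given [f = x], whatever [y] is. *)
have H (xy : X * Y) : exists h : Om -> Y, mfin h /\ forall z,
    pr (C xy.1 `&` [set w | g w = xy.2] `&` [set w | h w = z]) =
    m xy.1 xy.2 * m xy.1 z / pr (C xy.1).
  apply: (exists_fin_pr (g point)) => [|z|]; first exact: mC.
    by rewrite divr_ge0 ?mulr_ge0// pr_ge0.
  by rewrite -mulr_suml -mulr_sumr summ mK.
have [h hP] := choice H.
pose g' w := h (f w, g w) w.
have mg' : mfin g'.
  apply: (mfin_dep (f := fun w => (f w, g w))); first exact: mfin_pair.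
  by move=> x; have [] := hP x.
have prg' x y z : pr (C x `&` [set w | g w = y] `&` [set w | g' w = z]) =
    m x y * m x z / pr (C x).
  rewrite -((hP (x, y)).2 z); congr pr.
  by apply/seteqP; split=> w /= [[<- <-] <-].
exists g', (fun x => [arg max_(y > g point) m x y]%O); split=> //.
  move=> [x z].
  have E (k' : Om -> Y) : [set w | (f w, k' w) = (x, z)] =
      C x `&` [set w | k' w = z].
    by rewrite /C; apply/seteqP; split=> w /= [-> ->].
  rewrite !E (pr_fin (f := g) (E := C x `&` [set w | g' w = z]))//; last first.
    by apply: measurableI; [exact: mf|exact: mg'].
  under eq_bigr => y _ do rewrite setIAC prg'.
  by rewrite -mulr_suml -mulr_suml summ [X in X / _]mulrC mK.
move=> x; rewrite (pr_fin (f := g) _ mg); last first.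
  apply: measurableI; first exact: mf.
  exact: (mfin_pred (fun yz => yz.1 = yz.2) (mfin_pair mg mg')).
case: arg_maxP => // z _ zmax.
apply: (@le_trans _ _ (\sum_y m x y * m x z / pr (C x))).
  apply: ler_sum => y _.
  have -> : C x `&` [set w | g w = g' w] `&` [set w | g w = y] =
      C x `&` [set w | g w = y] `&` [set w | g' w = y].
    apply/seteqP; split=> w /= [[Cw]].
      by move=> E Ey; split; rewrite -?E.
    by move=> Ey Ey'; split; rewrite ?Ey ?Ey'.
  rewrite prg' ler_wpM2r ?invr_ge0 ?pr_ge0// ler_wpM2l//.
  exact: zmax.
by rewrite -!mulr_suml summ [X in X / _]mulrC mK.
Qed.

End Splitting.

(** * Quantifier elimination in nice randomizations *)

Section NiceRandomization.
Variables (R : realType) (L : signature) (M : structure L).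
Variable N : nice_randomization R M.

Local Notation Om := (nr_space N).
Local Notation NN := (nr_prestructure N).
Local Notation P := (nr_prob N).

Definition valuation m (a : 'I_m -> sortK NN) (w : Om) : 'I_m -> M :=
  fun i => sval (a i) w.

Lemma valuation_scons m (x : sortK NN) (a : 'I_m -> sortK NN) w :
  valuation (scons x a) w = scons (sval x w) (valuation a w).
Proof. exact: (comp_scons (fun f : sortK NN => sval f w)). Qed.

Lemma measurable_fodef m (Q : forall M : structure L, ('I_m -> M) -> Prop)
    (a : 'I_m -> sortK NN) :
  fodef Q -> measurable [set w | Q M (valuation a w)].
Proof.
move=> [phi phiQ].
have := nr_event_measurable phi (fun i => svalP (a i)).
rewrite (_ : event _ _ = [set w | Q M (valuation a w)])//.
by apply/seteqP; split=> w /phiQ.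
Qed.

Lemma mfin_fdef m (X : finType) (F : forall M : structure L, ('I_m -> M) -> X)
    (a : 'I_m -> sortK NN) :
  fdef F -> mfin (fun w => F M (valuation a w)).
Proof. by move=> dF x; exact: (measurable_fodef a (dF x)). Qed.

(** All random elements constructed below come from this measurable choice of witnesses, the
    pointwise form of [nr_witness]. *)
Lemma fodef_witness m (Q : forall M : structure L, ('I_m.+1 -> M) -> Prop)
    (a : 'I_m -> sortK NN) : fodef Q ->
  exists x : sortK NN, forall w, (exists u, Q M (scons u (valuation a w))) ->
    Q M (valuation (scons x a) w).
Proof.
move=> [phi phiQ].
have [x Kx Ex] := nr_witness phi (fun i => svalP (a i)).
exists (exist _ x Kx) => w [u Qu].
have : event (FEx phi) (fun i => sval (a i)) w by exists u; apply/phiQ.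
by rewrite -Ex /event/= (comp_scons (fun f => f w)) valuation_scons => /phiQ.
Qed.

(** Every measurable set is the event of some formula [psi] at parameters [c], so the case
    distinction is first-order in [x], [y] and [c] and can be witnessed. *)
Lemma glue (x y : sortK NN) (E : set Om) : measurable E ->
  exists z : sortK NN, forall w,
    sval z w = if `[< E w >] then sval x w else sval y w.
Proof.
move=> /(@nr_measurable_event _ _ _ N)[k [psi [c [Kc ->]]]].
(* Variable 0 is the element sought, 1 and 2 are [x] and [y], and [s] lists the parameters of
   [psi]. *)
pose s i : 'I_k.+3 := lift ord0 (lift ord0 (lift ord0 i)).
pose Q (M : structure L) (v : 'I_k.+3 -> M) :=
  (satisfies psi (fun i => v (s i)) /\ v ord0 = v (lift ord0 ord0)) \/
  (~ satisfies psi (fun i => v (s i)) /\ v ord0 = v (lift ord0 (lift ord0 ord0))).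
have dpsi : fodef (fun M (v : 'I_k.+3 -> M) => satisfies psi (fun i => v (s i))).
  exact: (fodef_ren s (fodef_formula psi)).
have dQ : fodef Q.
  apply: fodef_or; apply: fodef_and; [exact: dpsi|exact: fodef_eq| |
    exact: fodef_eq].
  exact: fodef_not.
pose a := scons x (scons y (fun i => exist _ (c i) (Kc i) : sortK NN)).
have [z zP] := fodef_witness a dQ.
have EQ u w : Q M (scons u (valuation a w)) <->
    (event psi c w /\ u = sval x w) \/ (~ event psi c w /\ u = sval y w).
  rewrite /Q /a !valuation_scons !scons_lift !scons0.
  by rewrite (_ : (fun i => _) = (fun i => c i w))//; apply/funext => i;
    rewrite /s !scons_lift.
exists z => w; have := zP w; rewrite valuation_scons => H.
have /EQ[] : Q M (scons (sval z w) (valuation a w)).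
  apply: H; have [Ew|nEw] := pselect (event psi c w).
    by exists (sval x w); apply/EQ; left.
  by exists (sval y w); apply/EQ; right.
  by move=> [Ew ->]; rewrite asboolT.
by move=> [Ew ->]; rewrite asboolF.
Qed.

Lemma glue_fin (Y : finType) (h : Om -> Y) (x : Y -> sortK NN) : mfin h ->
  exists z : sortK NN, forall w, sval z w = sval (x (h w)) w.
Proof.
move=> mh; suff [z zP] : exists z : sortK NN, forall w, h w \in enum Y ->
    sval z w = sval (x (h w)) w.
  by exists z => w; apply: zP; rewrite mem_enum.
elim: (enum Y) => [|y s [z zP]]; first by exists (x (h point)).
have [z' z'P] := glue (x y) z (mh y).
exists z' => w; rewrite z'P inE; case: asboolP => [<-//|ne].
by move=> /orP[/eqP|/zP].
Qed.

Definition bpattern n (E : 'I_n -> sortB NN) (w : Om) : {ffun 'I_n -> bool} :=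
  [ffun j => `[< sval (E j) w >]].

(** The finite random data whose law will determine the value of a continuous formula: a finite type
    of the elements and a record of which event parameters contain [w]. *)
Definition state m n (X : finType) (F : forall M : structure L, ('I_m -> M) -> X)
    (a : 'I_m -> sortK NN) (E : 'I_n -> sortB NN) (w : Om) :
    X * {ffun 'I_n -> bool} :=
  (F M (valuation a w), bpattern E w).

Lemma mfin_bpattern n (E : 'I_n -> sortB NN) : mfin (bpattern E).
Proof.
move=> e; rewrite (_ : [set _ | _] =
  \bigcap_(j in [set: 'I_n]) [set w | `[< sval (E j) w >] = e j]).
  apply: fin_bigcap_measurable => // j _.
  by apply: mfin_bool; exact: (svalP (E j)).
apply/seteqP; split=> w /= H.
  by move=> j _ /=; rewrite -H ffunE.
by apply/ffunP => j; rewrite ffunE; exact: H.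
Qed.

Lemma mfin_state m n (X : finType) (F : forall M : structure L, ('I_m -> M) -> X)
    (a : 'I_m -> sortK NN) (E : 'I_n -> sortB NN) :
  fdef F -> mfin (state F a E).
Proof.
by move=> dF; apply: mfin_pair; [exact: mfin_fdef|exact: mfin_bpattern].
Qed.

(** The type one quantifier higher, as in Ehrenfeucht-Fraisse games. *)
Definition realized m (X : finType)
    (F : forall M : structure L, ('I_m.+1 -> M) -> X) (M' : structure L)
    (v : 'I_m -> M') : {set X} :=
  [set x | `[< exists u, F M' (scons u v) = x >]]%SET.

(** Back-and-forth for random elements. The type [g] of [x] over [a] is copied to a variable [g'];
    almost surely [g'] is a type realizable over [a'], because realizability is recorded in the law,
    and witnesses glued along [g'] form [x']. *)
Lemma samelaw_extendK m n (X : finType)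
    (F : forall M : structure L, ('I_m.+1 -> M) -> X)
    (a a' : 'I_m -> sortK NN) (E E' : 'I_n -> sortB NN) : fdef F ->
  samelaw P (state (realized F) a E) (state (realized F) a' E') ->
  forall x, exists x', samelaw P (state F (scons x a) E) (state F (scons x' a') E').
Proof.
move=> dF same x.
have dF' : fdef (realized F) by apply: fdef_set => y; exact: fodef_ex (dF y).
pose g w := F M (valuation (scons x a) w).
have mg : mfin g by exact: mfin_fdef.
have mf := mfin_state a E dF'; have mf' := mfin_state a' E' dF'.
have [g' [mg' same']] := samelaw_extend (@nr_atomless _ _ _ N) mf mf' mg same.
have [wit witP] := choice (fun y => fodef_witness a' (dF y)).
have [x' x'P] := glue_fin wit mg'.
exists x'.
pose Q (z : {set X} * {ffun 'I_n -> bool} * X) := z.2 \notin z.1.1.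
have Z0 : pr P [set w | Q (state (realized F) a' E' w, g' w)] = 0.
  rewrite -(samelaw_pred Q (mfin_pair mf mg) (mfin_pair mf' mg') same').
  rewrite (_ : [set _ | _] = set0) ?pr_set0//; apply/seteqP; split=> // w.
  rewrite /Q /= inE => /negP; apply; apply/asboolP; exists (sval x w).
  by rewrite /g valuation_scons.
have mZ := mfin_pred Q (mfin_pair mf' mg').
pose k (z : {set X} * {ffun 'I_n -> bool} * X) := (z.2, z.1.2).
have := samelaw_comp k (mfin_pair mf mg) (mfin_pair mf' mg') same'.
move=> same2 y; rewrite (same2 y).
apply: (samelaw_ae _ _ mZ Z0) => [||w /negP].
- exact: (mfin_comp k (mfin_pair mf' mg')).
- exact: mfin_state.
rewrite negbK /= inE => /asboolP/witP E1.
rewrite /k /state/= -{1}E1 !valuation_scons; congr (F M (scons _ _), _).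
by rewrite x'P.
Qed.

(** Back-and-forth for events: the indicator of [B] is copied. Any measurable set is allowed as
    [B'], so no richer [F] is called for. *)
Lemma samelaw_extendB m n (X : finType)
    (F : forall M : structure L, ('I_m -> M) -> X)
    (a a' : 'I_m -> sortK NN) (E E' : 'I_n -> sortB NN) : fdef F ->
  samelaw P (state F a E) (state F a' E') ->
  forall B, exists B', samelaw P (state F a (scons B E)) (state F a' (scons B' E')).
Proof.
move=> dF same B.
have mf := mfin_state a E dF; have mf' := mfin_state a' E' dF.
have mg := mfin_bool (svalP B).
have [g' [mg' same']] := samelaw_extend (@nr_atomless _ _ _ N) mf mf' mg same.
exists (exist _ _ (mg' true)).
pose k (z : X * {ffun 'I_n -> bool} * bool) := (z.1.1, finfun (scons z.2 z.1.2)).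
have := samelaw_comp k (mfin_pair mf mg) (mfin_pair mf' mg') same'.
set f1 := k \o _; set f2 := k \o _.
have -> : f1 = state F a (scons B E).
  apply/funext => w; rewrite /f1 /k /state/=; congr pair; apply/ffunP => j.
  rewrite !ffunE; case: (unliftP ord0 j) => [i ->|->].
    by rewrite !scons_lift ffunE.
  by rewrite !scons0.
set s := state F a' _; have -> // : f2 = s.
apply/funext => w; rewrite /f2 /s /k /state/=; congr pair; apply/ffunP => j.
rewrite !ffunE; case: (unliftP ord0 j) => [i ->|->].
  by rewrite !scons_lift ffunE.
by rewrite !scons0 /=; case: (g' w); [rewrite asboolT|rewrite asboolF].
Qed.

End NiceRandomization.

(** * Closure properties of definable finite-valued maps *)

Lemma fdef_bool L n (Q : forall M : structure L, ('I_n -> M) -> Prop) :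
  fodef Q -> fdef (fun M v => `[< Q M v >]).
Proof.
move=> dQ [].
  by apply: (fodef_ext _ dQ) => M v; split=> [/asboolT|/asboolP].
by apply: (fodef_ext _ (fodef_not dQ)) => M v; split=> [/asboolF|/asboolPn].
Qed.

Lemma fdef_pair L n (X Y : finType)
    (F : forall M : structure L, ('I_n -> M) -> X)
    (G : forall M : structure L, ('I_n -> M) -> Y) :
  fdef F -> fdef G -> fdef (fun M v => (F M v, G M v)).
Proof.
move=> dF dG [x y]; apply: (fodef_ext _ (fodef_and (dF x) (dG y))) => M v.
by split=> [[-> ->]|[]].
Qed.

Lemma fdef_dffun L n (J : finType) (X : J -> finType)
    (F : forall j, forall M : structure L, ('I_n -> M) -> X j) :
  (forall j, fdef (F j)) ->
  fdef (fun M v => [ffun j => F j M v] : {dffun forall j, X j}).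
Proof.
move=> dF x.
have H j : fodef (fun M v => F j M v <> x j) by apply: fodef_not; exact: dF.
apply: (fodef_ext _ (fodef_not (fodef_fin_ex H))) => M v; split.
  move=> nH; apply/ffunP => j; rewrite ffunE.
  by apply: contrapT => ne; apply: nH; exists j.
by move=> <- [j]; rewrite ffunE.
Qed.

Lemma fdef_ren L n m (s : 'I_n -> 'I_m) (X : finType)
    (F : forall M : structure L, ('I_n -> M) -> X) :
  fdef F -> fdef (fun M v => F M (fun i => v (s i))).
Proof. by move=> dF x; exact: (fodef_ren s (dF x)). Qed.

(** * Determinacy of continuous formulas by joint laws *)

Section Determinacy.
Variables (R : realType) (L : signature).

(** Boolean operations act pointwise, so the state at [w] already decides whether [w] lies in the
    value of the term. *)
Lemma beval_state m n (t : bterm L m n) :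
  exists (X : finType) (F : forall M : structure L, ('I_m -> M) -> X)
      (h : X * {ffun 'I_n -> bool} -> bool), fdef F /\
    forall (M : structure L) (N : nice_randomization R M)
      (a : 'I_m -> sortK (nr_prestructure N))
      (E : 'I_n -> sortB (nr_prestructure N)) w,
    sval (beval t a E) w <-> h (state F a E w).
Proof.
elim: t => [i|k phi x| | |s [X [F [h [dF hP]]]] t [Y [G [k [dG kP]]]]
  |s [X [F [h [dF hP]]]] t [Y [G [k [dG kP]]]]|s [X [F [h [dF hP]]]]].
- exists unit, (fun _ _ => tt), (fun z : unit * {ffun 'I_n -> bool} => z.2 i).
  split.
    by move=> x; exact: fodef_const.
  by move=> M N a E w; rewrite /state/= ffunE; split=> /asboolP.
- exists bool, (fun _ v => `[< satisfies phi (fun j => v (x j)) >]), (fun z => z.1).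
  split; first by apply: fdef_bool; exact: (fodef_ren x (fodef_formula phi)).
  by move=> M N a E w; rewrite /state/=; split=> /asboolP.
- exists unit, (fun _ _ => tt), (fun=> true); split=> //.
  by move=> x; exact: fodef_const.
- exists unit, (fun _ _ => tt), (fun=> false); split=> //.
  by move=> x; exact: fodef_const.
- exists (X * Y)%type, (fun M v => (F M v, G M v)),
    (fun z => h (z.1.1, z.2) && k (z.1.2, z.2)).
  split=> [|M N a E w]; first exact: fdef_pair.
  have := hP M N a E w; have := kP M N a E w.
  by rewrite /state/= => Hk Hh; split=> [[/Hh -> /Hk]//|/andP[/Hh ? /Hk]].
- exists (X * Y)%type, (fun M v => (F M v, G M v)),
    (fun z => h (z.1.1, z.2) || k (z.1.2, z.2)).
  split=> [|M N a E w]; first exact: fdef_pair.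
  have := hP M N a E w; have := kP M N a E w.
  rewrite /state/= => Hk Hh; split=> [[/Hh -> //|/Hk ->]|/orP[/Hh|/Hk]].
  - by rewrite orbT.
  - by left.
  - by right.
- exists X, F, (fun z => ~~ h z); split=> // M N a E w.
  rewrite -[sval _ w]/(~ sval (beval s a E) w) hP.
  by split=> /negP.
Qed.

Definition determined m n (Phi : cformula R L m n) (X : finType)
    (F : forall M : structure L, ('I_m -> M) -> X) :=
  forall (M : structure L) (N : nice_randomization R M)
    (a a' : 'I_m -> sortK (nr_prestructure N))
    (E E' : 'I_n -> sortB (nr_prestructure N)),
  samelaw (nr_prob N) (state F a E) (state F a' E') ->
  cvalue Phi a E = cvalue Phi a' E'.

(* Exact quantifier elimination in nice randomizations: the value of a
   continuous formula is a function of the joint law of finitely many events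
   of the form [[phi(a)]] and of the event parameters. *)
Lemma exists_determined m n (Phi : cformula R L m n) :
  exists (X : finType) (F : forall M : structure L, ('I_m -> M) -> X),
    fdef F /\ determined Phi F.
Proof.
(* Quantifiers see only the range of values. Back-and-forth in both directions makes two ranges
   equal, so no approximation is involved. *)
have range_sym (A B : Type) (f : A -> R) (g : B -> R) :
    (forall x, exists y, f x = g y) -> (forall y, exists x, g y = f x) ->
    range f = range g.
  move=> fg gf; apply/seteqP; split=> _ [x _ <-].
    by have [y ->] := fg x; exists y.
  by have [y ->] := gf x; exists y.
elim: Phi => {m n} [m n t|m n s t|m n i j|m n k u Psi IH|
  m n Psi [X [F [dF FP]]]|m n Psi [X [F [dF FP]]]|
  m n Psi [X [F [dF FP]]]|m n Psi [X [F [dF FP]]]].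
- have [X [F [h [dF hP]]]] := beval_state t.
  exists X, F; split=> // M N a a' E E' same /=.
  have H (b : 'I_m -> sortK (nr_prestructure N))
      (D : 'I_n -> sortB (nr_prestructure N)) :
      sval (beval t b D) = [set w | h (state F b D w)].
    by apply/seteqP; split=> w /hP.
  by rewrite !H; apply: (samelaw_pred h) => //; exact: mfin_state.
(* The symmetric difference is itself an event term, and the distance is its measure. *)
- have [X [F [h [dF hP]]]] :=
    beval_state (BCup (BCap s (BNeg t)) (BCap t (BNeg s))).
  exists X, F; split=> // M N a a' E E' same /=; rewrite /nr_dB.
  have H (b : 'I_m -> sortK (nr_prestructure N))
      (D : 'I_n -> sortB (nr_prestructure N)) :
      sval (beval s b D) `+` sval (beval t b D) =
      [set w | h (state F b D w)].
    by apply/seteqP; split=> w /hP.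
  by rewrite !H; apply: (samelaw_pred h) => //; exact: mfin_state.
- pose F (M : structure L) (v : 'I_m -> M) := `[< v i = v j >].
  have dF : fdef F by apply: fdef_bool; exact: fodef_eq.
  exists bool, F; split=> // M N a a' E E' same /=; rewrite /nr_dK.
  have H (b : 'I_m -> sortK (nr_prestructure N))
      (D : 'I_n -> sortB (nr_prestructure N)) :
      [set w | sval (b i) w <> sval (b j) w] =
      [set w | ~~ (state F b D w).1].
    by apply/seteqP; split=> w /= /asboolPn.
  rewrite (H a E) (H a' E'); apply: (samelaw_pred (fun z => ~~ z.1)) => //;
    exact: mfin_state.
- have {}IH j : exists XF :
        {X : finType & forall M : structure L, ('I_m -> M) -> X},
      fdef (projT2 XF) /\ determined (Psi j) (projT2 XF).
    by have [X [F FP]] := IH j; exists (existT _ X F).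
  have [XF XFP] := choice IH.
  (* The types belonging to the finitely many subformulas are recorded jointly, in a dependent
     product. *)
  pose F (M : structure L) (v : 'I_m -> M) :=
    [ffun j => projT2 (XF j) M v] : {dffun forall j, projT1 (XF j)}.
  have dF : fdef F by apply: fdef_dffun => j; have [] := XFP j.
  exists {dffun forall j, projT1 (XF j)}, F; split=> //.
  move=> M N a a' E E' same /=; congr cfun; apply/rowP => j; rewrite !mxE.
  apply: (XFP j).2.
  pose proj (z : {dffun forall j, projT1 (XF j)} * {ffun 'I_n -> bool}) :=
    (z.1 j, z.2).
  have H (b : 'I_m -> sortK (nr_prestructure N))
      (D : 'I_n -> sortB (nr_prestructure N)) :
      state (projT2 (XF j)) b D = proj \o state F b D.
    by apply/funext => w; rewrite /proj /state/= ffunE.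
  by rewrite !H; apply: samelaw_comp => //; exact: mfin_state.
- exists {set X}, (realized F); split.
    by apply: fdef_set => y; exact: fodef_ex (dF y).
  move=> M N a a' E E' same /=; congr sup; apply: range_sym => x.
    by have [y /FP] := samelaw_extendK dF same x; exists y.
  by have [y /FP] := samelaw_extendK dF (samelaw_sym same) x; exists y.
- exists {set X}, (realized F); split.
    by apply: fdef_set => y; exact: fodef_ex (dF y).
  move=> M N a a' E E' same /=; congr inf; apply: range_sym => x.
    by have [y /FP] := samelaw_extendK dF same x; exists y.
  by have [y /FP] := samelaw_extendK dF (samelaw_sym same) x; exists y.
- exists X, F; split=> // M N a a' E E' same /=; congr sup.
  apply: range_sym => x.
    by have [y /FP] := samelaw_extendB dF same x; exists y.
  by have [y /FP] := samelaw_extendB dF (samelaw_sym same) x; exists y.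
- exists X, F; split=> // M N a a' E E' same /=; congr inf.
  apply: range_sym => x.
    by have [y /FP] := samelaw_extendB dF same x; exists y.
  by have [y /FP] := samelaw_extendB dF (samelaw_sym same) x; exists y.
Qed.

(** These types pin down an element over [v]; the functional formulas are made from them. *)
Definition uniquely_realized m (X : finType)
    (F : forall M : structure L, ('I_m.+1 -> M) -> X) (M : structure L)
    (v : 'I_m -> M) : {set X} :=
  [set x | `[< exists u, F M (scons u v) = x /\
     ~ exists u', F M (scons u' v) = x /\ u' <> u >]]%SET.

Lemma fodef_other m (X : finType) (x : X)
    (F : forall M : structure L, ('I_m.+1 -> M) -> X) : fdef F ->
  fodef (fun M (v : 'I_m.+2 -> M) =>
    F M (scons (v ord0) (fun i => v (lift ord0 (lift ord0 i)))) = x /\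
    v ord0 <> v (lift ord0 ord0)).
Proof.
move=> dF; apply: fodef_and; last by apply: fodef_not; exact: fodef_eq.
have := fodef_ren (scons ord0 (fun i : 'I_m => lift ord0 (lift ord0 i))) (dF x).
apply: fodef_ext => M v /=.
by rewrite (comp_scons v).
Qed.

Lemma fdef_uniquely_realized m (X : finType)
    (F : forall M : structure L, ('I_m.+1 -> M) -> X) :
  fdef F -> fdef (uniquely_realized F).
Proof.
move=> dF; apply: fdef_set => x.
pose Q (M : structure L) (v : 'I_m.+1 -> M) := F M v = x /\ ~ exists u' : M,
  F M (scons u' (fun i => v (lift ord0 i))) = x /\ u' <> v ord0.
have dQ : fodef Q.
  apply: fodef_and; first exact: dF.
  apply: fodef_not; apply: fodef_ext (fodef_ex (fodef_other x dF)) => M v.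
  split=> -[u]; rewrite ?scons0 ?scons_lift => H; exists u; move: H.
    rewrite (_ : (fun i => scons u v _) = (fun i => v (lift ord0 i)))//.
    by apply/funext => i; rewrite scons_lift.
  rewrite ?scons0 ?scons_lift.
  rewrite (_ : (fun i => scons u v _) = (fun i => v (lift ord0 i)))//.
  by apply/funext => i; rewrite scons_lift.
apply: fodef_ext (fodef_ex dQ) => M v.
have vE u : (fun i => scons u v (lift ord0 i)) = v.
  by apply/funext => i; rewrite scons_lift.
by split=> -[u]; rewrite /Q; [rewrite vE scons0|move=> H; rewrite /Q];
  exists u => //; rewrite vE scons0.
Qed.

End Determinacy.

(** * Moving an element while preserving the value of a continuous formula *)

Section Displacement.
Variables (R : realType) (L : signature).

(* Resampling the type of [b] independently over [a], and moving [b] to another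
   realization of its type wherever that type has several ones, yields [x].
   Almost surely [x = b] forces the type of [b] to be one of those that [a]
   realizes exactly once, and to be drawn twice in a row; for the best choice [c]
   of such a type this is no more likely than [b] having the type chosen
   by [c]. *)
Lemma functional_approximation m (Phi : cformula R L m.+1 0) :
  exists (C : finType) (phi : C -> formula L m.+1),
    (forall c (M : structure L) (v : 'I_m -> M) u u',
       satisfies (phi c) (scons u v) -> satisfies (phi c) (scons u' v) -> u = u') /\
    forall (M : structure L) (N : nice_randomization R M)
      (b : sortK (nr_prestructure N)) (a : 'I_m -> sortK (nr_prestructure N)),
    exists x, cvalue Phi (scons x a) (@snil (sortB (nr_prestructure N))) =
              cvalue Phi (scons b a) (@snil (sortB (nr_prestructure N))) /\
      exists c, dB (evt (nr_prestructure N) (phi c) (scons b a)) (btop _) <= dK x b.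
Proof.
have [X [F [dF FPhi]]] := exists_determined Phi.
pose tl n (M : structure L) (v : 'I_n.+1 -> M) := fun i => v (lift ord0 i).
have tlE n (M : structure L) (u : M) (v : 'I_n -> M) : tl n M (scons u v) = v.
  by apply/funext => i; rewrite /tl scons_lift.
pose S := uniquely_realized F.
have dS : fdef S by exact: fdef_uniquely_realized.
have dFS : fdef (fun M v => (F M v, S M (tl m M v))).
  by apply: fdef_pair => //; exact: (fdef_ren (lift ord0) dS).
(* [c] selects a type for each possible set of uniquely realized types. Requiring that the selected
   type be in the set makes the formula functional, and there are only finitely many [c]. *)
pose Q (c : {ffun {set X} -> X}) (M : structure L) (v : 'I_m.+1 -> M) :=
  F M v = c (S M (tl m M v)) /\ c (S M (tl m M v)) \in S M (tl m M v).
have dQ c : fodef (Q c).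
  exact: (fdef_pred (fun z : X * {set X} => z.1 = c z.2 /\ c z.2 \in z.2) dFS).
have [phi phiP] := choice dQ.
exists {ffun {set X} -> X}, phi; split.
  move=> c M v u u' /phiP + /phiP; rewrite /Q !tlE => -[Fu +] [Fu' _].
  rewrite /S /uniquely_realized inE => /asboolP[u0 [_ u0P]].
  have H u1 : F M (scons u1 v) = c (S M v) -> u1 = u0.
    by move=> E; apply: contrapT => ne; apply: u0P; exists u1.
  by rewrite (H u Fu) (H u' Fu').
move=> M N b a; pose P := nr_prob N.
pose Sa w := S M (valuation a w).
pose g w := F M (valuation (scons b a) w).
(* Where the type of [b] has several realizations, [f] also reveals that type, so that resampling
   given [f] cannot change it there. *)
pose f w := (Sa w, if g w \in Sa w then None else Some (g w)).
have mSa : mfin Sa by exact: mfin_fdef.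
have mg : mfin g by exact: mfin_fdef.
have mf : mfin f.
  pose k (z : {set X} * X) := (z.1, if z.2 \in z.1 then None else Some z.2).
  exact: (mfin_comp k (mfin_pair mSa mg)).
have [g' [c [mg' same cP]]] := independent_copy (@nr_atomless _ _ _ N) mf mg.
have mfg' := mfin_pair mf mg'.
(* This holds everywhere for [(f, g)], hence almost surely for [(f, g')], which has the same law. *)
pose good (z : {set X} * option X * X) :=
  if z.1.2 is Some t then z.2 = t else z.2 \in z.1.1.
have mZ : measurable [set w | ~ good (f w, g' w)].
  exact: (mfin_pred (fun z => ~ good z) mfg').
have Z0 : pr P [set w | ~ good (f w, g' w)] = 0.
  rewrite -(samelaw_pred (fun z => ~ good z) (mfin_pair mf mg) mfg' same).
  rewrite (_ : [set _ | _] = set0) ?pr_set0//; apply/seteqP; split=> // w.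
  by rewrite /good /f /=; case: ifP.
have [wit witP] := choice (fun t => fodef_witness a (dF t)).
have [alt altP] := choice (fun t => fodef_witness (scons b a) (fodef_other t dF)).
pose h w := (f w, g w, g' w).
(* If the type of [b] is uniquely realized, [b] is kept when the same type is drawn again, and
   otherwise a witness of the new type is taken. If it has several realizations, one other than [b]
   is taken. *)
pose pick (z : {set X} * option X * X * X) :=
  if z.1.1.2 is None then if z.1.2 == z.2 then b else wit z.2 else alt z.1.2.
have [x xP] := glue_fin pick (mfin_pair (mfin_pair mf mg) mg').
have key w : good (f w, g' w) ->
    F M (valuation (scons x a) w) = g' w /\
    (sval x w = sval b w -> (f w).2 = None /\ g w = g' w).
  rewrite valuation_scons xP /pick /good /f /=.
  case: ifPn => gS gg'.
    have [E|ne] := eqVneq (g w) (g' w).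
      by rewrite -E /g valuation_scons; split.
    move: (gg'); rewrite /Sa /S /uniquely_realized inE => /asboolP[u [Fu _]].
    have Fw : F M (scons (sval (wit (g' w)) w) (valuation a w)) = g' w.
      by rewrite -valuation_scons; apply: witP; exists u.
    split=> // Eb; move: ne; rewrite -Fw Eb /g valuation_scons.
    by rewrite eqxx.
  have [] : F M (valuation (scons (alt (g w)) a) w) = g w /\
      sval (alt (g w)) w <> sval b w.
    have E (y : sortK (nr_prestructure N)) :
        (fun i => valuation (scons y (scons b a)) w (lift ord0 (lift ord0 i))) =
        valuation a w.
      by apply/funext => i; rewrite /valuation !scons_lift.
    have := altP (g w) w; rewrite E !valuation_scons !scons_lift !scons0; apply.
    apply: contrapT => nex; move: gS.
    rewrite /Sa /S /uniquely_realized inE => /asboolPn; apply.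
    exists (sval b w); split; first by rewrite /g valuation_scons.
    move=> [u' [Fu' ne]]; apply: nex; exists u'.
    rewrite !scons0 !scons_lift scons0; split=> //.
    rewrite -[RHS]Fu'; congr (F M (scons _ _)); apply/funext => i.
    by rewrite !scons_lift.
  by rewrite valuation_scons gg' => -> ne; split.
exists x; split.
  apply: FPhi.
  pose k (t : X) := (t, [ffun=> false] : {ffun 'I_0 -> bool}).
  have e0 w : bpattern (@snil (sortB (nr_prestructure N))) w = [ffun=> false].
    by apply/ffunP => -[].
  have -> : state F (scons b a) (@snil (sortB (nr_prestructure N))) = k \o g.
    by apply/funext => w; rewrite /state e0.
  have -> : state F (scons x a) (@snil (sortB (nr_prestructure N))) =
      k \o (fun w => F M (valuation (scons x a) w)).
    by apply/funext => w; rewrite /state e0.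
  apply: samelaw_comp => //; first exact: mfin_fdef.
  apply: samelaw_sym => y.
  rewrite (samelaw_comp snd (mfin_pair mf mg) mfg' same).
  apply: (samelaw_ae _ _ mZ Z0) => // [|w /contrapT/key[]//].
  exact: mfin_fdef.
(* Only fibres of [f] with second component [None] matter, and these are indexed by the set of
   uniquely realized types alone. *)
pose c0 := [ffun s => c (s, None)] : {ffun {set X} -> X}; exists c0.
pose U := [set w | satisfies (phi c0) (valuation (scons b a) w)].
have mU : measurable U.
  exact: (measurable_fodef (scons b a) (fodef_formula (phi c0))).
have -> : dB (evt (nr_prestructure N) (phi c0) (scons b a)) (btop _) = 1 - pr P U.
  rewrite -pr_setC//; congr fine; congr (P _).
  by apply/seteqP; split=> w /=; rewrite /U/=; tauto.
pose V := [set w | sval x w = sval b w].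
have mV : measurable V.
  have := measurable_fodef (scons x (scons b a)) (fodef_eq L ord0 (lift ord0 ord0)).
  rewrite (_ : [set _ | _] = V)//; apply/seteqP; split=> w;
  by rewrite /= !valuation_scons scons0 scons_lift scons0.
have -> : dK x b = 1 - pr P V by rewrite -pr_setC.
rewrite lerD2l lerN2.
(* [V] lies in [D1] up to a null event and [D2] lies in [U]; the bound [cP], summed over the fibres
   of [f], compares [D1] with [D2]. *)
pose D1 := [set w | (f w).2 = None /\ g w = g' w].
pose D2 := [set w | (f w).2 = None /\ g w = c (f w)].
have mD1 : measurable D1.
  apply: (mfin_pred (fun z => z.1.1.2 = None /\ z.1.2 = z.2)
    (mfin_pair (mfin_pair mf mg) mg')).
have mD2 : measurable D2.
  exact: (mfin_pred (fun z => z.1.2 = None /\ z.2 = c z.1) (mfin_pair mf mg)).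
apply: (@le_trans _ _ (pr P D1)).
  rewrite -[leRHS]addr0 -Z0.
  apply: (@le_trans _ _ (pr P (D1 `|` ([set w | ~ good (f w, g' w)] `\` D1)))).
    apply: le_pr => //.
      by apply: measurableU => //; exact: measurableD.
    move=> w Vw; have [/key[_ /(_ Vw)]|nG] := pselect (good (f w, g' w)).
      by left.
    by have [|nD] := pselect (D1 w); [left|right].
  rewrite prU//; [|exact: measurableD|by rewrite setDIK].
  by rewrite lerD2l le_pr//; exact: measurableD.
apply: (@le_trans _ _ (pr P D2)); last first.
  apply: le_pr => // w [+ gc]; rewrite /f /=; case: ifPn => // gS _.
  apply/phiP; rewrite /Q valuation_scons tlE -/(Sa w) /c0 ffunE.
  have fE : f w = (Sa w, None) by rewrite /f gS.
  by rewrite -valuation_scons -/(g w) -fE -gc.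
rewrite (pr_fin P (f := f) mD1)// (pr_fin P (f := f) mD2)//; apply: ler_sum => z _.
have [zN|zN] := eqVneq z.2 None; last first.
  rewrite (_ : D1 `&` _ = set0) ?pr_set0 ?pr_ge0//.
  by apply/seteqP; split=> // w [[+ _] /= fz]; rewrite fz => E; rewrite E in zN.
have -> : D1 `&` [set w | f w = z] = [set w | f w = z] `&` [set w | g w = g' w].
  apply/seteqP; split=> w [] => [[_ gg] fz|fz gg]; split=> //.
  by split=> //; rewrite fz.
have -> : D2 `&` [set w | f w = z] = [set w | f w = z] `&` [set w | g w = c z].
  apply/seteqP; split=> w /= [] => [[_ gc] fz|fz gc]; split; rewrite -?fz//.
  by split=> //; rewrite fz.
exact: cP.
Qed.

End Displacement.

(** * Continuous formulas *)

Section Connectives.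
Variables (R : realType) (L : signature).

Lemma cvalue01 (N : prestructure R L) m n (Phi : cformula R L m n)
    (a : 'I_m -> sortK N) (e : 'I_n -> sortB N) : 0 <= cvalue Phi a e <= 1.
Proof.
have sup01 (X : Type) (f : X -> R) : inhabited X ->
    (forall x, 0 <= f x <= 1) -> 0 <= sup (range f) <= 1.
  move=> [x0] f01.
  have ub1 : ubound (range f) 1 by move=> _ [x _ <-]; have /andP[] := f01 x.
  apply/andP; split; last by apply: ge_sup => //; exists (f x0), x0.
  apply: (@le_trans _ _ (f x0)); first by have /andP[] := f01 x0.
  by apply: ub_le_sup; [exists 1|exists x0].
have inf01 (X : Type) (f : X -> R) : inhabited X ->
    (forall x, 0 <= f x <= 1) -> 0 <= inf (range f) <= 1.
  move=> [x0] f01.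
  have lb0 : lbound (range f) 0 by move=> _ [x _ <-]; have /andP[] := f01 x.
  apply/andP; split; first by apply: lb_le_inf => //; exists (f x0), x0.
  apply: (@le_trans _ _ (f x0)); last by have /andP[] := f01 x0.
  by apply: ge_inf; [exists 0|exists x0].
have inhB : inhabited (sortB N) by constructor; exact: btop.
have inhK := sortK_inhabited N.
elim: Phi a e => {m n} [m n t|m n s t|m n i j|m n k u Psi IH|
  m n Psi IH|m n Psi IH|m n Psi IH|m n Psi IH] a e /=.
- by rewrite mu_ge0 mu_le1.
- by rewrite (pm_ge0 (dB_pseudometric N)) (pm_le1 (dB_pseudometric N)).
- by rewrite (pm_ge0 (dK_pseudometric N)) (pm_le1 (dK_pseudometric N)).
- by apply: cfun_range => j; rewrite mxE.
- exact: sup01.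
- exact: inf01.
- exact: sup01.
- exact: inf01.
Qed.

Lemma exists_binary (g : R -> R -> R) :
  (forall f h : 'rV[R]_2 -> R^o, continuous f -> continuous h ->
     continuous (fun v => g (f v) (h v) : R^o)) ->
  (forall x y, 0 <= x <= 1 -> 0 <= y <= 1 -> 0 <= g x y <= 1) ->
  forall m n (Phi Psi : cformula R L m n), exists Chi : cformula R L m n,
    forall (N : prestructure R L) (a : 'I_m -> sortK N) (e : 'I_n -> sortB N),
      cvalue Chi a e = g (cvalue Phi a e) (cvalue Psi a e).
Proof.
move=> g_cont g01 m n Phi Psi.
pose f (v : 'rV[R]_2) := g (v ord0 ord0) (v ord0 (lift ord0 ord0)).
have f_cont : {within @cube R 2, continuous f}.
  apply: continuous_subspaceT; apply: g_cont; exact: coord_continuous.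
have f01 v : cube v -> 0 <= f v <= 1 by move=> cv; apply: g01.
exists (CConn (Connective f_cont f01)
  (fun j => if j == ord0 then Phi else Psi)) => N a e.
by rewrite /= /f !mxE.
Qed.

Lemma exists_min m n (Phi Psi : cformula R L m n) :
  exists Chi : cformula R L m n,
    forall (N : prestructure R L) (a : 'I_m -> sortK N) (e : 'I_n -> sortB N),
      cvalue Chi a e = Num.min (cvalue Phi a e) (cvalue Psi a e).
Proof.
apply: exists_binary => [f h cf ch v|x y /andP[x0 x1] /andP[y0 y1]].
  by apply: continuous_min; [exact: cf|exact: ch].
by rewrite le_min x0 y0 ge_min x1.
Qed.

Lemma exists_max m n (Phi Psi : cformula R L m n) :
  exists Chi : cformula R L m n,
    forall (N : prestructure R L) (a : 'I_m -> sortK N) (e : 'I_n -> sortB N),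
      cvalue Chi a e = Num.max (cvalue Phi a e) (cvalue Psi a e).
Proof.
apply: exists_binary => [f h cf ch v|x y /andP[x0 x1] /andP[y0 y1]].
  by apply: continuous_max; [exact: cf|exact: ch].
by rewrite le_max x0 ge_max x1 y1.
Qed.

(** Truth being the value 0, an inequality between two values is expressed by the vanishing of this
    truncated difference. *)
Lemma exists_dotminus m n (Phi Psi : cformula R L m n) :
  exists Chi : cformula R L m n,
    forall (N : prestructure R L) (a : 'I_m -> sortK N) (e : 'I_n -> sortB N),
      cvalue Chi a e = Num.max 0 (cvalue Phi a e - cvalue Psi a e).
Proof.
apply: (@exists_binary (fun x y => Num.max 0 (x - y))) =>
    [f h cf ch v|x y /andP[x0 x1] /andP[y0 y1]].
  apply: (@continuous_max _ _ (fun=> 0) (fun v => f v - h v)).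
    exact: cst_continuous.
  by apply: continuousB; [exact: cf|exact: ch].
by rewrite le_max lexx ge_max ler01/= lerBlDr; apply: (le_trans x1); rewrite lerDl.
Qed.

Lemma exists_distance m n (Phi Psi : cformula R L m n) :
  exists Chi : cformula R L m n,
    forall (N : prestructure R L) (a : 'I_m -> sortK N) (e : 'I_n -> sortB N),
      cvalue Chi a e = `|cvalue Phi a e - cvalue Psi a e|.
Proof.
have [C1 C1E] := exists_dotminus Phi Psi; have [C2 C2E] := exists_dotminus Psi Phi.
have [C CE] := exists_max C1 C2; exists C => N a e; rewrite CE C1E C2E.
set x := cvalue Phi a e; set y := cvalue Psi a e.
have [xy|/ltW yx] := leP x y.
  rewrite (max_l (_ : x - y <= 0)) ?subr_le0// maxA maxxx max_r ?subr_ge0//.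
  by rewrite distrC ger0_norm ?subr_ge0.
rewrite (max_l (_ : y - x <= 0)) ?subr_le0// maxC maxA maxxx max_r ?subr_ge0//.
by rewrite ger0_norm ?subr_ge0.
Qed.

Lemma exists_one m n : exists Chi : cformula R L m n,
  forall (N : prestructure R L) (a : 'I_m -> sortK N) (e : 'I_n -> sortB N),
    cvalue Chi a e = 1.
Proof.
have f_cont : {within @cube R 0, continuous (fun=> 1 : R)}.
  by apply: continuous_subspaceT; exact: cst_continuous.
have f01 (v : 'rV[R]_0) : cube v -> 0 <= (1 : R) <= 1.
  by move=> _; rewrite ler01 lexx.
by exists (CConn (Connective f_cont f01) (@snil _)).
Qed.

(* The constant 1 serves as the minimum of the empty family. *)
Lemma exists_fin_min m n (C : finType) (Phi : C -> cformula R L m n) :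
  exists Chi : cformula R L m n,
    forall (N : prestructure R L) (a : 'I_m -> sortK N) (e : 'I_n -> sortB N),
      (forall c, cvalue Chi a e <= cvalue (Phi c) a e) /\
      (cvalue Chi a e < 1 -> exists c, cvalue (Phi c) a e <= cvalue Chi a e).
Proof.
suff [Chi ChiP] : exists Chi : cformula R L m n,
    forall (N : prestructure R L) (a : 'I_m -> sortK N) (e : 'I_n -> sortB N),
      (forall c, c \in enum C -> cvalue Chi a e <= cvalue (Phi c) a e) /\
      (cvalue Chi a e < 1 -> exists c, cvalue (Phi c) a e <= cvalue Chi a e).
  exists Chi => N a e; have [H H'] := ChiP N a e; split=> // c.
  by apply: H; rewrite mem_enum.
elim: (enum C) => [|c s [Chi ChiP]].
  by have [Chi ChiE] := exists_one m n; exists Chi => N a e;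
     rewrite ChiE ltxx.
have [Chi' Chi'E] := exists_min (Phi c) Chi; exists Chi' => N a e.
have [H H'] := ChiP N a e; rewrite Chi'E; split.
  move=> d; rewrite inE => /orP[/eqP ->|/H le]; first by rewrite ge_min lexx.
  by rewrite ge_min le orbT.
have [le|gt] := leP (cvalue (Phi c) a e) (cvalue Chi a e).
  by exists c.
by move=> /H'.
Qed.

(** * Renaming of variables in continuous formulas *)

Fixpoint bren m n m' (f : 'I_m -> 'I_m') (t : bterm L m n) : bterm L m' n :=
  match t with
  | BVar i => BVar L m' i
  | BEvt k phi x => BEvt n phi (fun j => f (x j))
  | BTop => BTop L m' n
  | BBot => BBot L m' n
  | BCap s t => BCap (bren f s) (bren f t)
  | BCup s t => BCup (bren f s) (bren f t)
  | BNeg s => BNeg (bren f s)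
  end.

Fixpoint cren m n (Phi : cformula R L m n) :
    forall m', ('I_m -> 'I_m') -> cformula R L m' n :=
  match Phi in cformula _ _ m n return
    forall m', ('I_m -> 'I_m') -> cformula R L m' n with
  | CMu _ _ t => fun _ f => CMu R (bren f t)
  | CDistB _ _ s t => fun _ f => CDistB R (bren f s) (bren f t)
  | CDistK _ n i j => fun _ f => CDistK R L n (f i) (f j)
  | CConn _ _ k u Psi => fun _ f => CConn u (fun j => cren (Psi j) f)
  | CSupK _ _ Psi => fun _ f => CSupK (cren Psi (upren f))
  | CInfK _ _ Psi => fun _ f => CInfK (cren Psi (upren f))
  | CSupB _ _ Psi => fun _ f => CSupB (cren Psi f)
  | CInfB _ _ Psi => fun _ f => CInfB (cren Psi f)
  end.

Lemma beval_bren (N : prestructure R L) m n m' (f : 'I_m -> 'I_m')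
    (t : bterm L m n) (a : 'I_m' -> sortK N) (e : 'I_n -> sortB N) :
  beval (bren f t) a e = beval t (fun i => a (f i)) e.
Proof. by elim: t => //= [s -> t ->|s -> t ->|s ->]. Qed.

Lemma scons_upren (X : Type) m m' (f : 'I_m -> 'I_m') (x : X) (a : 'I_m' -> X) :
  (fun i => scons x a (upren f i)) = scons x (fun i => a (f i)).
Proof.
rewrite /upren comp_scons scons0; congr scons.
by apply/funext => i; rewrite scons_lift.
Qed.

Lemma cvalue_cren (N : prestructure R L) m n (Phi : cformula R L m n) m'
    (f : 'I_m -> 'I_m') (a : 'I_m' -> sortK N) (e : 'I_n -> sortB N) :
  cvalue (cren Phi f) a e = cvalue Phi (fun i => a (f i)) e.
Proof.
elim: Phi m' f a e => {m n} [m n t|m n s t|m n i j|m n k u Psi IH|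
  m n Psi IH|m n Psi IH|m n Psi IH|m n Psi IH] m' f a e /=.
- by rewrite beval_bren.
- by rewrite !beval_bren.
- by [].
- by congr cfun; apply/rowP => j; rewrite !mxE IH.
- by under eq_fun do rewrite IH scons_upren.
- by under eq_fun do rewrite IH scons_upren.
- by under eq_fun do rewrite IH.
- by under eq_fun do rewrite IH.
Qed.

Lemma cvalue_sup_ge (N : prestructure R L) m n (Phi : cformula R L m.+1 n)
    (a : 'I_m -> sortK N) (e : 'I_n -> sortB N) x :
  cvalue Phi (scons x a) e <= cvalue (CSupK Phi) a e.
Proof.
apply: (@ub_le_sup _ (range (fun y => cvalue Phi (scons y a) e))); last by exists x.
by exists 1 => _ [y _ <-]; have /andP[] := cvalue01 Phi (scons y a) e.
Qed.

Lemma cvalue_inf_le (N : prestructure R L) m n (Phi : cformula R L m.+1 n)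
    (a : 'I_m -> sortK N) (e : 'I_n -> sortB N) x :
  cvalue (CInfK Phi) a e <= cvalue Phi (scons x a) e.
Proof.
apply: (@ge_inf _ (range (fun y => cvalue Phi (scons y a) e))); last by exists x.
by exists 0 => _ [y _ <-]; have /andP[] := cvalue01 Phi (scons y a) e.
Qed.

Lemma cvalue_inf_lt (N : prestructure R L) m n (Phi : cformula R L m.+1 n)
    (a : 'I_m -> sortK N) (e : 'I_n -> sortB N) (r : R) :
  cvalue (CInfK Phi) a e < r -> exists x, cvalue Phi (scons x a) e < r.
Proof.
move=> lt; apply: contrapT => nex.
have [x0] := sortK_inhabited N.
have : r <= cvalue (CInfK Phi) a e.
  apply: (@lb_le_inf _ (range (fun y => cvalue Phi (scons y a) e)));
    first by exists (cvalue Phi (scons x0 a) e), x0.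
  by move=> _ [x _ <-]; rewrite leNgt; apply/negP => ltx; apply: nex; exists x.
by rewrite leNgt lt.
Qed.

End Connectives.

(** * Definable elements in models of the randomization theory *)

Section Transfer.
Variables (R : realType) (L : signature) (T : theory L).

Definition nice_true m (Phi : cformula R L m 0) :=
  forall M : structure L, fomodel T M -> forall (N : nice_randomization R M)
    (a : 'I_m -> sortK (nr_prestructure N)),
  cvalue Phi a (@snil (sortB (nr_prestructure N))) = 0.

Variable N : prestructure R L.
Hypothesis N_model : randomization_model T N.

Local Notation val Phi a := (cvalue Phi a (@snil (sortB N))).

(** Suprema over the free variables turn [Phi] into a sentence of the theory: values being
    nonnegative, a supremum is 0 exactly when all values are. *)
Lemma transfer m (Phi : cformula R L m 0) : nice_true Phi ->
  forall a : 'I_m -> sortK N, val Phi a = 0.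
Proof.
elim: m Phi => [|m IH] Phi Phi0 a.
  rewrite (snil_eq a); apply: N_model.2 => M TM N0; exact: Phi0.
have sup0 : nice_true (CSupK Phi).
  move=> M TM N0 b; pose e := @snil (sortB (nr_prestructure N0)).
  have [x0] := sortK_inhabited (nr_prestructure N0).
  have /andP[ge0 _] := cvalue01 (CSupK Phi) b e.
  apply/eqP; rewrite eq_le ge0 andbT.
  apply: (@ge_sup _ (range (fun x => cvalue Phi (scons x b) e))).
    by exists (cvalue Phi (scons x0 b) e), x0.
  by move=> _ [x _ <-]; rewrite (Phi0 M TM N0).
have := cvalue_sup_ge Phi (fun i => a (lift ord0 i)) (@snil (sortB N)) (a ord0).
rewrite (IH _ sup0) scons_eta => le0; apply/eqP; rewrite eq_le le0.
by have /andP[] := cvalue01 Phi a (@snil (sortB N)).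
Qed.

(** The sum on the right may exceed 1 and so need not be the value of a formula; two truncated
    subtractions replace it. *)
Lemma transfer_leD m (Phi Psi Chi : cformula R L m 0) :
  (forall M : structure L, fomodel T M -> forall (N0 : nice_randomization R M)
      (a : 'I_m -> sortK (nr_prestructure N0)),
    cvalue Phi a (@snil (sortB (nr_prestructure N0))) <=
    cvalue Psi a (@snil (sortB (nr_prestructure N0))) +
    cvalue Chi a (@snil (sortB (nr_prestructure N0)))) ->
  forall a : 'I_m -> sortK N, val Phi a <= val Psi a + val Chi a.
Proof.
move=> le a.
have [D DE] := exists_dotminus Phi Psi; have [D' D'E] := exists_dotminus D Chi.
have D'0 : nice_true D'.
  move=> M TM N0 b; rewrite D'E DE; apply/max_idPl; rewrite subr_le0 ge_max.
  have /andP[-> _] /= := cvalue01 Chi b (@snil (sortB (nr_prestructure N0))).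
  by rewrite lerBlDl; exact: le.
have := transfer D'0 a; rewrite D'E DE => /max_idPl.
by rewrite subr_le0 ge_max lerBlDl => /andP[].
Qed.

Lemma transfer_le m (Phi Psi : cformula R L m 0) :
  (forall M : structure L, fomodel T M -> forall (N0 : nice_randomization R M)
      (a : 'I_m -> sortK (nr_prestructure N0)),
    cvalue Phi a (@snil (sortB (nr_prestructure N0))) <=
    cvalue Psi a (@snil (sortB (nr_prestructure N0)))) ->
  forall a : 'I_m -> sortK N, val Phi a <= val Psi a.
Proof.
pose Z := CDistB R (BTop L m 0) (BTop L m 0).
have Z0 (N' : prestructure R L) (a : 'I_m -> sortK N') :
  cvalue Z a (@snil (sortB N')) = 0 by exact: (pm_refl (dB_pseudometric N')).
move=> le a; have := @transfer_leD _ Phi Psi Z _ a.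
by rewrite Z0 addr0; apply => M TM N0 b; rewrite Z0 addr0 le.
Qed.

(** In a nice randomization this is the probability that [phi] fails at [a]. *)
Definition defect m (phi : formula L m) (a : 'I_m -> sortK N) : R :=
  dB (evt N phi a) (btop N).

Definition cdefect m k (phi : formula L k) (f : 'I_k -> 'I_m) : cformula R L m 0 :=
  CDistB R (BEvt 0 phi f) (BTop L m 0).

Lemma nice_cdefect (M : structure L) (N0 : nice_randomization R M) m k
    (phi : formula L k) (f : 'I_k -> 'I_m)
    (b : 'I_m -> sortK (nr_prestructure N0)) :
  cvalue (cdefect phi f) b (@snil (sortB (nr_prestructure N0))) =
  pr (nr_prob N0) [set w | ~ satisfies phi (valuation (fun j => b (f j)) w)].
Proof.
congr fine; congr (nr_prob N0 _).
by apply/seteqP; split=> w /=; rewrite /event/=; tauto.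
Qed.

Lemma defect_eq0 m (phi : formula L m) (a : 'I_m -> sortK N) :
  defect phi a = 0 -> evt N phi a = btop N.
Proof. exact: (dB_separated N_model.1). Qed.

Lemma evt_defect0 m (phi : formula L m) (a : 'I_m -> sortK N) :
  evt N phi a = btop N -> defect phi a = 0.
Proof. by rewrite /defect => ->; exact: (pm_refl (dB_pseudometric N)). Qed.

Lemma le_defect m (phi psi : formula L m) (a : 'I_m -> sortK N) :
  (forall M : structure L, fomodel T M -> forall v : 'I_m -> M,
     satisfies phi v -> satisfies psi v) -> defect psi a <= defect phi a.
Proof.
move=> imp.
apply: (@transfer_le _ (cdefect psi id) (cdefect phi id)) => M TM N0 b.
rewrite !nice_cdefect; apply: le_pr;
  [exact: (measurable_fodef b (fodef_not (fodef_formula _)))..|].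
by move=> w /= npsi /(imp M TM).
Qed.

Lemma defect_inconsistent m (phi : formula L m) (a : 'I_m -> sortK N) :
  (forall M : structure L, fomodel T M ->
     forall v : 'I_m -> M, ~ satisfies phi v) ->
  1 <= defect phi a.
Proof.
move=> ncons; have [one oneE] := exists_one R L m 0.
have := @transfer_le _ one (cdefect phi id) _ a; rewrite oneE; apply.
move=> M TM N0 b; rewrite oneE nice_cdefect.
rewrite (_ : [set _ | _] = setT) ?pr_setT//.
by apply/seteqP; split=> // w _ /=; exact: ncons.
Qed.

Lemma defect_scons_le m (phi : formula L m.+1) (a : 'I_m -> sortK N) x y :
  defect phi (scons x a) <= dK x y + defect phi (scons y a).
Proof.
apply: (le_trans (pm_triangle (dB_pseudometric N) _ (evt N phi (scons y a)) _)).
rewrite lerD2r; apply: (le_trans (evt_lipschitz _ _ _)).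
rewrite big_ord_recl !scons0 big1 ?addr0// => i _.
by rewrite !scons_lift (pm_refl (dK_pseudometric N)).
Qed.

(** Where [phi] holds of both elements they coincide, so the event that they differ is covered by
    the two events of failure. *)
Lemma dK_le_defect m (phi : formula L m.+1) (a : 'I_m -> sortK N) x y :
  functional T phi -> dK x y <= defect phi (scons x a) + defect phi (scons y a).
Proof.
move=> fphi.
(* In the tuple [(x, y, a)], [s] reads off [(x, a)] and [lift ord0] reads off [(y, a)]. *)
pose s : 'I_m.+1 -> 'I_m.+2 := scons ord0 (fun i => lift ord0 (lift ord0 i)).
pose v := scons x (scons y a).
have E1 : val (CDistK R L 0 (ord0 : 'I_m.+2) (lift ord0 ord0)) v = dK x y.
  by rewrite /= /v scons0 scons_lift scons0.
have E2 : val (cdefect phi s) v = defect phi (scons x a).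
  rewrite /= /defect; congr (dB (evt N phi _) _).
  rewrite /v /s comp_scons scons0; congr scons.
  by apply/funext => i; rewrite !scons_lift.
have E3 : val (cdefect phi (lift ord0)) v = defect phi (scons y a).
  rewrite /= /defect; congr (dB (evt N phi _) _).
  by apply/funext => i; rewrite /v scons_lift.
rewrite -E1 -E2 -E3; apply: transfer_leD => M TM N0 b.
rewrite !nice_cdefect.
rewrite -[leLHS]/(pr (nr_prob N0)
  [set w | sval (b ord0) w <> sval (b (lift ord0 ord0)) w]).
have mphi (f : 'I_m.+1 -> 'I_m.+2) : measurable
    [set w | ~ satisfies phi (valuation (fun j => b (f j)) w)].
  exact: (measurable_fodef _ (fodef_not (fodef_formula phi))).
have mneq : measurable [set w | sval (b ord0) w <> sval (b (lift ord0 ord0)) w].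
  exact: (measurable_fodef b (fodef_not (fodef_eq L ord0 (lift ord0 ord0)))).
apply: le_prU => // w /= ne.
apply: contrapT => /not_orP[/contrapT H1 /contrapT H2]; apply: ne.
pose d i := sval (b (lift ord0 (lift ord0 i))) w.
apply: (fphi M TM d).
  move: H1; rewrite (_ : valuation _ w = scons (sval (b ord0) w) d)//.
  by rewrite /valuation /s (comp_scons (fun j => sval (b j) w)).
by move: H2; rewrite -[valuation _ w]scons_eta.
Qed.

(** Nice randomizations have exact witnesses, but what transfers to [N] is that the infimum is 0,
    hence only approximate ones. *)
Lemma inf_defect m (phi : formula L m.+1) (a : 'I_m -> sortK N) (r : R) :
  (forall M : structure L, fomodel T M -> forall v : 'I_m -> M,
     exists u, satisfies phi (scons u v)) ->
  0 < r -> exists x, defect phi (scons x a) < r.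
Proof.
move=> tphi r0.
have inf0 : nice_true (CInfK (cdefect phi id)).
  move=> M TM N0 b; have [x xP] := fodef_witness b (fodef_formula phi).
  apply/eqP; rewrite eq_le.
  have /andP[-> _] := cvalue01 (CInfK (cdefect phi id)) b
    (@snil (sortB (nr_prestructure N0))).
  rewrite andbT.
  apply: (le_trans (cvalue_inf_le (cdefect phi id) b (@snil _) x)).
  rewrite nice_cdefect (_ : [set _ | _] = set0) ?pr_set0//.
  by apply/seteqP; split=> // w /=; apply; apply: xP; exact: tphi.
by apply: (@cvalue_inf_lt _ _ _ _ _ (cdefect phi id) a (@snil _) r);
  rewrite transfer.
Qed.

(** By functionality, elements of small defect are close to each other, so approximate witnesses
    form a Cauchy sequence; its limit has defect 0. *)
Lemma exists_realization m (phi : formula L m.+1) (a : 'I_m -> sortK N) :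
  functional T phi ->
  (forall M : structure L, fomodel T M -> forall v : 'I_m -> M,
     exists u, satisfies phi (scons u v)) ->
  exists x, evt N phi (scons x a) = btop N.
Proof.
move=> fphi tphi.
have [c cP] := choice (fun k : nat => @inf_defect _ phi a k.+1%:R^-1 tphi
  (ltac:(by rewrite invr_gt0))).
have small (e : R) : 0 < e -> exists K : nat, forall i, (K <= i)%N ->
    defect phi (scons (c i) a) < e.
  move=> e0; have [K _ HK] := cvgr0_norm_lt _ (@cvg_harmonic R) _ e0.
  exists K => i Ki; apply: (lt_trans (cP i)).
  by have := HK i Ki; rewrite /= ger0_norm// invr_ge0.
have [|x xP] := dK_complete N_model.1 (s := c).
  move=> e e0; have [|K HK] := small (e / 2); first by rewrite divr_gt0.
  exists K => i j Ki Kj; apply: (le_lt_trans (dK_le_defect _ _ _ fphi)).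
  by have := HK i Ki; have := HK j Kj; lra.
exists x; apply: defect_eq0; apply/eqP; rewrite eq_le (pm_ge0 (dB_pseudometric N)).
rewrite andbT; apply/ler_addgt0Pr => e e0; rewrite add0r.
have e20 : 0 < e / 2 by rewrite divr_gt0.
have [K HK] := small _ e20.
have [K' _ HK'] := cvgr0_norm_lt _ xP _ e20.
pose i := maxn K K'.
have := HK i (leq_maxl _ _); have := HK' i (leq_maxr _ _).
rewrite /= ger0_norm ?(pm_ge0 (dK_pseudometric N))// => d1 d2.
have := defect_scons_le phi a x (c i).
rewrite (pm_sym (dK_pseudometric N)); lra.
Qed.

(** * From definable elements to nearby first-order definable ones *)

Hypothesis T_complete : complete_theory T.
Variable A : set (sortK N).

(** An exact realization [c] of a total functional formula is at distance at most the defect from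
    [b]. It remains to make [phi] total without raising the defect at [b]. *)
Lemma fdcl_near m (phi : formula L m.+1) (a : 'I_m -> sortK N) b (r : R) :
  functional T phi -> (forall i, A (a i)) -> defect phi (scons b a) < r -> r <= 1 ->
  exists2 c, fdcl T A c & dK c b < r.
Proof.
have total k (psi : formula L k.+1) (d : 'I_k -> sortK N) : functional T psi ->
    (forall i, A (d i)) -> defect psi (scons b d) < r ->
    (forall M : structure L, fomodel T M -> forall v : 'I_k -> M,
       exists u, satisfies psi (scons u v)) ->
    exists2 c, fdcl T A c & dK c b < r.
  move=> fpsi Ad lt tpsi; have [c cP] := exists_realization d fpsi tpsi.
  exists c; first by exists k, psi, d.
  by apply: (le_lt_trans (dK_le_defect d c b fpsi)); rewrite evt_defect0// add0r.
case: m phi a => [|m] phi a fphi Aa lt r1.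
  (* Without parameters there is no default element. Instead the theory decides whether [phi] has a
     realization; if it has none, the defect is at least 1, against [r <= 1]. *)
  have [ex|nex] := T_complete.2 (FEx phi).
    by apply: (total _ phi a) => // M TM v; rewrite (snil_eq v); exact: (ex M TM).
  have : 1 <= defect phi (scons b a).
    apply: defect_inconsistent => M TM v sat; apply: (nex M TM).
    exists (v ord0); rewrite -(snil_eq (fun i => v (lift ord0 i))).
    by rewrite scons_eta.
  by rewrite leNgt (lt_le_trans lt r1).
(* Where [phi] has no realization, take the first parameter. *)
pose Q (M : structure L) (v : 'I_m.+2 -> M) := satisfies phi v \/
  (~ (exists u, satisfies phi (scons u (fun i => v (lift ord0 i)))) /\
   v ord0 = v (lift ord0 ord0)).
have [psi psiP] : fodef Q.
  apply: fodef_or; first exact: fodef_formula.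
  apply: fodef_and; last exact: fodef_eq.
  apply: fodef_not.
  exact: (fodef_ren (lift ord0) (fodef_ex (fodef_formula phi))).
have tail (M : structure L) (u : M) (v : 'I_m.+1 -> M) :
    (fun i => scons u v (lift ord0 i)) = v.
  by apply/funext => i; rewrite scons_lift.
apply: (total _ psi a) => //.
- move=> M TM v u u' /psiP + /psiP; rewrite /Q !tail !scons0 !scons_lift.
  move=> [Hu|[nex ->]] [Hu'|[nex' ->]] //.
  + exact: (fphi M TM v).
  + by case: nex'; exists u.
  + by case: nex; exists u'.
- apply: le_lt_trans lt; apply: le_defect => M TM v phiv.
  by apply/psiP; left.
- move=> M TM v; have [[u Hu]|nex] := pselect (exists u, satisfies phi (scons u v)).
    by exists u; apply/psiP; left.
  by exists (v ord0); apply/psiP; right; rewrite tail scons0 scons_lift.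
Qed.

Lemma definable_fdcl_near b (r : R) : definable_over A b -> 0 < r ->
  exists2 c, fdcl T A c & dK c b < r.
Proof.
move=> [n [Phi_ [a_ [Aa PhiP]]]] r0.
(* The cap at 1 is what [fdcl_near] asks for, and it ensures that the minimum [B] is reached by some
   [phi c] and is not the default 1. *)
pose r' := Num.min r 1; have r'0 : 0 < r' by rewrite lt_min r0 ltr01.
have [r'r r'1] : r' <= r /\ r' <= 1 by rewrite !ge_min !lexx orbT.
suff [c fc lt] : exists2 c, fdcl T A c & dK c b < r'.
  by exists c => //; exact: lt_le_trans lt r'r.
(* Four errors will add up: the approximation of the distance at [x] and at [b], the difference
   between [Phi] at [x] and at [b], and the excess of the minimal defect over [dK x b]. *)
have e0 : 0 < r' / 4 by rewrite divr_gt0.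
have [K _ /(_ K (leqnn K)) /=] := PhiP _ e0.
move: (Phi_ K) (a_ K) (Aa K); move: (n K) => m Phi a {}Aa near.
have [C [phi [fphi approx]]] := functional_approximation Phi.
pose s : 'I_m.+1 -> 'I_m.+2 := scons ord0 (fun i => lift ord0 (lift ord0 i)).
have sE (X : Type) (u v : X) (d : 'I_m -> X) :
    (fun j => scons u (scons v d) (s j)) = scons u d.
  rewrite /s comp_scons scons0; congr scons; apply/funext => i.
  by rewrite !scons_lift.
have liftE (X : Type) (u : X) k (d : 'I_k -> X) :
    (fun j => scons u d (lift ord0 j)) = d.
  by apply/funext => i; rewrite scons_lift.
(* [Th] at [(x, b, a)] is the larger of the difference of [Phi(x, a)] and [Phi(b, a)] and of the
   excess of the least defect of a [phi c] at [(b, a)] over [dK x b]. The displaced element makes it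
   0 in nice randomizations, so its infimum over [x] is 0 in [N]. *)
have [D DE] := exists_distance (cren Phi s) (cren Phi (lift ord0)).
have [B BP] := exists_fin_min
  (fun c => cdefect (phi c) (lift ord0 : 'I_m.+1 -> 'I_m.+2)).
have [B' B'E] := exists_dotminus B (CDistK R L 0 (ord0 : 'I_m.+2) (lift ord0 ord0)).
have [Th ThE] := exists_max D B'.
have inf0 : nice_true (CInfK Th).
  move=> M TM N0 d; apply/eqP; rewrite eq_le.
  have /andP[-> _] := cvalue01 (CInfK Th) d (@snil (sortB (nr_prestructure N0))).
  rewrite andbT -(scons_eta d).
  set y := d ord0; set d' := fun i => _.
  have [x [xE [c cP]]] := approx M N0 y d'.
  apply: (le_trans (cvalue_inf_le Th (scons y d') (@snil _) x)).
  rewrite ThE DE B'E !cvalue_cren sE liftE xE subrr normr0 ge_max lexx /=.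
  rewrite ge_max lexx /= subr_le0 scons0 scons_lift scons0.
  apply: le_trans cP; have [/(_ c) + _] := BP (nr_prestructure N0)
    (scons x (scons y d')) (@snil _).
  by rewrite /= liftE.
have [x] : exists x, val Th (scons x (scons b a)) < r' / 4.
  by apply: cvalue_inf_lt; rewrite (transfer inf0).
rewrite ThE DE B'E !cvalue_cren sE liftE gt_max => /andP[near1].
rewrite gt_max => /andP[_]; rewrite /= scons0 scons_lift scons0 => near2.
have nearx := near x; have nearb := near b.
rewrite (pm_refl (dK_pseudometric N)) subr0 in nearb.
move: near1 nearx nearb; rewrite !ltr_norml => /andP[? ?] /andP[? ?] /andP[? ?].
have [_ Bc] := BP N (scons x (scons b a)) (@snil _).
have [|c] := Bc; first by lra.
rewrite /= liftE -/(defect _ _) => cB.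
apply: (fdcl_near (phi := phi c) (a := a)) => //; last by lra.
by move=> M TM v u u'; exact: fphi.
Qed.

End Transfer.

(** * Limits of first-order definable elements *)

Section Definability_of_limits.
Variables (R : realType) (L : signature) (T : theory L) (N : prestructure R L).
Hypothesis N_model : randomization_model T N.
Variable A : set (sortK N).

(** The Lipschitz bound gives one inequality and functionality the other, so [phi] yields an exact
    formula for the distance to [b]. *)
Lemma defect_functional m (phi : formula L m.+1) (a : 'I_m -> sortK N) b x :
  functional T phi -> evt N phi (scons b a) = btop N ->
  defect phi (scons x a) = dK x b.
Proof.
move=> fphi /evt_defect0 b0; apply/eqP; rewrite eq_le.
have := defect_scons_le phi a x b; have := dK_le_defect N_model a x b fphi.
by rewrite b0 !addr0 => -> ->.
Qed.

(** The defect formulas of the [b_ k] compute the distances to [b_ k], which differ from the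
    distance to [b] by at most [dK (b_ k) b], uniformly in [x]. *)
Lemma fdcl_limit_definable b (b_ : nat -> sortK N) :
  (forall k, fdcl T A (b_ k)) -> (fun k => dK (b_ k) b) @ \oo --> (0 : R) ->
  definable_over A b.
Proof.
move=> fb cvgb.
(* Arity, formula and parameters are packed together so that one application of choice selects all
   three. *)
pose Q (k : nat) (p : {m : nat & (formula L m.+1 * ('I_m -> sortK N))%type}) :=
  [/\ functional T (projT2 p).1, forall i, A ((projT2 p).2 i) &
      evt N (projT2 p).1 (scons (b_ k) (projT2 p).2) = btop N].
have exQ k : exists p, Q k p.
  by have [m [phi [a H]]] := fb k; exists (existT _ m (phi, a)).
have [p pP] := choice exQ.
exists (fun k => projT1 (p k)), (fun k => cdefect R (projT2 (p k)).1 id),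
  (fun k => (projT2 (p k)).2); split=> [k i|e e0]; first by have [_ + _] := pP k.
have [K _ HK] := cvgr0_norm_lt _ cvgb _ e0.
exists K => // k Kk x; have [fphi _ top] := pP k.
have -> : cvalue (cdefect R (projT2 (p k)).1 id) (scons x (projT2 (p k)).2)
    (@snil (sortB N)) = dK x (b_ k) by exact: defect_functional.
apply: le_lt_trans (HK k Kk) => /=.
rewrite (ger0_norm (pm_ge0 (dK_pseudometric N) _ _)).
have := pm_triangle (dK_pseudometric N) x (b_ k) b.
have := pm_triangle (dK_pseudometric N) x b (b_ k).
rewrite (pm_sym (dK_pseudometric N) b) => H1 H2.
by rewrite ler_norml; apply/andP; split; lra.
Qed.

Lemma metric_closureP (S : set (sortK N)) b :
  metric_closure S b <-> exists b_ : nat -> sortK N,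
    (forall k, S (b_ k)) /\ (fun k => dK (b_ k) b) @ \oo --> (0 : R).
Proof.
split=> [cb|[b_ [Sb cvgb]] e e0]; last first.
  have [K _ HK] := cvgr0_norm_lt _ cvgb _ e0; exists (b_ K) => //.
  by have := HK K (leqnn K); rewrite /= ger0_norm// (pm_ge0 (dK_pseudometric N)).
have near k : exists c, S c /\ dK c b < k.+1%:R^-1.
  have [|c Sc lt] := cb k.+1%:R^-1; first by rewrite invr_gt0.
  by exists c.
have [b_ bP] := choice near.
exists b_; split=> [k|]; first by have [] := bP k.
apply: (squeeze_cvgr _ (@cvg_cst _ _ _ _ _) (@cvg_harmonic R)).
apply: nearW => k; rewrite (pm_ge0 (dK_pseudometric N))/=.
by have [_ /ltW] := bP k.
Qed.

End Definability_of_limits.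

Theorem theorem3p18 (R : realType) (L : signature) (T : theory L)
    (T_complete : complete_theory T)
    (T_nontrivial : forall M : structure L, fomodel T M ->
       exists x y : M, x <> y)
    (N : prestructure R L) (N_model : randomization_model T N)
    (A : set (sortK N)) :
  (forall b : sortK N,
     definable_over A b <->
     exists b_ : nat -> sortK N,
       (forall m, fdcl T A (b_ m)) /\
       (fun m => dK (b_ m) b) @ \oo --> (0 : R)) /\
  dcl A = metric_closure (fdcl T A).
Proof.
have H b : definable_over A b <-> metric_closure (fdcl T A) b.
  split=> [db r r0|/metric_closureP[b_ [fb cvgb]]].
    exact: (definable_fdcl_near N_model T_complete).
  exact: (fdcl_limit_definable N_model fb).
split=> [b|]; first by rewrite -metric_closureP.
by apply/seteqP; split=> b /H.
Qed.
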